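(* Let $\mathcal{G} = (G^0,\mathcal{G}^1,r,s)$ be an ultragraph with no sinks, and let $\{s_e, p_A\}$ be the universal Cuntz-Krieger $\mathcal{G}$-family generating $C^*(\mathcal{G})$. Let $\mathcal{A}$ be the $C^*$-subalgebra of $C^*(\mathcal{G})$ generated by $\{p_A : A \in \mathcal{G}^0\}$, and let $X := \overline{\mathrm{span}}\{s_e p_A : e \in \mathcal{G}^1, A \in \mathcal{G}^0\} \subseteq C^*(\mathcal{G})$, regarded as a Hilbert $\mathcal{A}$-bimodule with right action given by right multiplication, left action given by left multiplication, and inner product $\langle x,y\rangle_{\mathcal{A}} := x^*y$. Then the Cuntz-Pimsner algebra $\mathcal{O}_X$ is canonically isomorphic to $C^*(\mathcal{G})$; that is, there is an isomorphism $C^*(\mathcal{G}) \to \mathcal{O}_X$ with $s_e \mapsto k_X(s_e)$ for $e \in \mathcal{G}^1$ and $p_A \mapsto k_{\mathcal{A}}(p_A)$ for $A \in \mathcal{G}^0$, where $(k_X,k_{\mathcal{A}})$ is the universal Cuntz-Pimsner covariant representation of $X$ in $\mathcal{O}_X$.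
   Context: An ultragraph $\mathcal{G} = (G^0, \mathcal{G}^1, r, s)$ consists of a countable set $G^0$ of vertices, a countable set $\mathcal{G}^1$ of edges, and functions $s : \mathcal{G}^1 \to G^0$ and $r : \mathcal{G}^1 \to P(G^0)$, where $P(G^0)$ is the collection of nonempty subsets of $G^0$. A sink is a vertex $v$ with $s^{-1}(v)=\emptyset$. $\mathcal{G}^0$ denotes the smallest collection of subsets of $G^0$ that contains $\{v\}$ for all $v \in G^0$, contains $r(e)$ for all $e \in \mathcal{G}^1$, and is closed under (nonempty) finite intersections and finite unions; the empty set is regarded as an element of $\mathcal{G}^0$. A Cuntz-Krieger $\mathcal{G}$-family is a collection of partial isometries $\{s_e : e \in \mathcal{G}^1\}$ with mutually orthogonal ranges and projections $\{p_A : A \in \mathcal{G}^0\}$ with: (i) $p_\emptyset = 0$, $p_Ap_B = p_{A\cap B}$, $p_{A \cup B} = p_A + p_B - p_{A \cap B}$ for all $A,B \in \mathcal{G}^0$; (ii) $s_e^*s_e = p_{r(e)}$; (iii) $s_es_e^* \leq p_{s(e)}$; (iv) $p_v = \sum_{s(e)=v} s_es_e^*$ whenever $0 < |s^{-1}(v)| < \infty$ (where $p_v := p_{\{v\}}$). $C^*(\mathcal{G})$ is the $C^*$-algebra generated by a universal Cuntz-Krieger $\mathcal{G}$-family. A Hilbert bimodule over $\mathcal{A}$ is a right Hilbert $\mathcal{A}$-module $X$ with a left action $\phi : \mathcal{A} \to \mathcal{L}(X)$ by adjointable operators. $\mathcal{K}(X)$ is the closed span of the operators $\Theta_{x,y}$,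 $\Theta_{x,y}(z) = x\langle y,z\rangle_{\mathcal{A}}$, and $J(X) := \phi^{-1}(\mathcal{K}(X))$. A Toeplitz representation $(\psi,\pi)$ of $X$ in a $C^*$-algebra $B$ is a linear map $\psi: X \to B$ and a homomorphism $\pi : \mathcal{A} \to B$ with $\psi(xa) = \psi(x)\pi(a)$, $\psi(x)^*\psi(y) = \pi(\langle x,y\rangle_{\mathcal{A}})$, $\psi(\phi(a)x) = \pi(a)\psi(x)$; it determines a homomorphism $\pi^{(1)} : \mathcal{K}(X) \to B$ with $\pi^{(1)}(\Theta_{x,y}) = \psi(x)\psi(y)^*$. It is Cuntz-Pimsner covariant (coisometric on $J(X)$) if $\pi^{(1)}(\phi(a)) = \pi(a)$ for all $a \in J(X)$. $\mathcal{O}_X$ is the $C^*$-algebra generated by the image of a universal Cuntz-Pimsner covariant Toeplitz representation $(k_X,k_{\mathcal{A}})$. *)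

(* Defs.v *)
From HB Require Import structures.
From mathcomp Require Import all_boot all_order all_algebra.
From mathcomp Require Import all_classical all_reals all_analysis.
From mathcomp Require Export complex.
Set Implicit Arguments.
Unset Strict Implicit.
Unset Printing Implicit Defensive.
Import Order.TTheory GRing.Theory Num.Theory.
Import numFieldNormedType.Exports.

Local Open Scope classical_set_scope.
Local Open Scope complex_scope.
Local Open Scope ring_scope.

(* The norm of a [normedModType R[i]] takes its values in [R[i]]; these values
   are nonnegative reals.  C*-algebras need not be unital (whereas MathComp's
   rings are), so the product is part of this mixin. *)
HB.mixin Record CompleteNormedModule_isCStar (R : realType) A
    of CompleteNormedModule R[i] A := {
  cmul : A -> A -> A ;
  star : A -> A ;
  cmulA : forall x y z, cmul x (cmul y z) = cmul (cmul x y) z ;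
  cmul_linearl : forall (k : R[i]) x y z,
    cmul (k *: x + y) z = k *: cmul x z + cmul y z ;
  cmul_linearr : forall (k : R[i]) x y z,
    cmul x (k *: y + z) = k *: cmul x y + cmul x z ;
  cnormM : forall x y, `|cmul x y| <= `|x| * `|y| ;
  starK : forall x, star (star x) = x ;
  star_semilinear : forall (k : R[i]) x y,
    star (k *: x + y) = k^* *: star x + star y ;
  starM : forall x y, star (cmul x y) = cmul (star y) (star x) ;
  cnorm_star : forall x, `|cmul (star x) x| = `|x| ^+ 2
}.

#[short(type="cstarType")]
HB.structure Definition CStar (R : realType) :=
  {A of CompleteNormedModule R[i] A & CompleteNormedModule_isCStar R A}.

Declare Scope cstar_scope.
Delimit Scope cstar_scope with cstar.
Notation "x ** y" := (cmul x y) (at level 40, left associativity) : cstar_scope.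
Notation "x ^^*" := (star x) (at level 1, format "x ^^*") : cstar_scope.
Local Open Scope cstar_scope.

Section CStarNotions.
Context {R : realType}.

Definition cpositive (A : cstarType R) (a : A) := exists b : A, a = b^^* ** b.

Definition cle (A : cstarType R) (a b : A) := cpositive (b - a).

Definition projection (A : cstarType R) (a : A) := a ** a = a /\ a^^* = a.

Definition partial_isometry (A : cstarType R) (a : A) := a ** a^^* ** a = a.

Definition starhom (A B : cstarType R) (f : A -> B) :=
  [/\ linear f, forall x y, f (x ** y) = f x ** f y
    & forall x, f (x^^*) = (f x)^^*].

Definition linspan (V : lmodType R[i]) (S : set V) : set V :=
  [set v | exists n (k : 'I_n -> R[i]) (x : 'I_n -> V),
     (forall i, S (x i)) /\ v = \sum_(i < n) k i *: x i].

Definition cstar_subalgebra (A : cstarType R) (M : set A) :=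
  [/\ closed M, M 0, forall (k : R[i]) x y, M x -> M y -> M (k *: x + y),
      forall x y, M x -> M y -> M (x ** y)
    & forall x, M x -> M (x^^*)].

Definition cstar_gen (A : cstarType R) (S : set A) : set A :=
  smallest (@cstar_subalgebra A) S.

End CStarNotions.

Record ultragraph := Ultragraph {
  vertex : countType ;
  edge : countType ;
  source : edge -> vertex ;
  range_of : edge -> set vertex ;
  range_of_neq0 : forall e, range_of e !=set0
}.

Definition no_sinks (G : ultragraph) :=
  forall v : vertex G, source (u := G) @^-1` [set v] !=set0.

Definition gsets (G : ultragraph) : set (set (vertex G)) :=
  smallest [set M | setI_closed M /\ setU_closed M]
    ([set set0] `|` [set [set v] | v in [set: vertex G]] `|`
     range (range_of (u := G))).

Section CuntzKrieger.
Context {R : realType}.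
Variable G : ultragraph.

(* [p] is a total function on sets of vertices, but only its values on
   [gsets G] are constrained (or used, here and below). *)
Record ck_family (B : cstarType R) (s : edge G -> B)
    (p : set (vertex G) -> B) : Prop := CKFamily {
  ck_isometry : forall e, partial_isometry (s e) ;
  ck_orthogonal : forall e f, e <> f ->
    (s e ** (s e)^^*) ** (s f ** (s f)^^*) = 0 ;
  ck_projection : forall A, gsets A -> projection (p A) ;
  ck_set0 : p set0 = 0 ;
  ck_setI : forall A A', gsets A -> gsets A' -> p A ** p A' = p (A `&` A') ;
  ck_setU : forall A A', gsets A -> gsets A' ->
    p (A `|` A') = p A + p A' - p (A `&` A') ;
  ck_range : forall e, (s e)^^* ** s e = p (range_of e) ;
  ck_source : forall e, cle (s e ** (s e)^^*) (p [set source e]) ;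
  ck_vertex : forall v,
    source (u := G) @^-1` [set v] !=set0 ->
    finite_set (source (u := G) @^-1` [set v]) ->
    p [set v] = \sum_(e \in source (u := G) @^-1` [set v]) (s e ** (s e)^^*)
}.

Record universal_ck_family (C : cstarType R) (s : edge G -> C)
    (p : set (vertex G) -> C) : Prop := UniversalCKFamily {
  uck_family : ck_family s p ;
  uck_generated : cstar_gen (range s `|` p @` @gsets G) = setT ;
  uck_universal : forall (B : cstarType R) (s' : edge G -> B)
      (p' : set (vertex G) -> B), ck_family s' p' ->
    exists! h : C -> B, [/\ starhom h, forall e, h (s e) = s' e
      & forall A, gsets A -> h (p A) = p' A]
}.

End CuntzKrieger.

(* Asking for the given complete norm on X to be the one induced by the inner
   product expresses the completeness of X. *)
HB.mixin Record CompleteNormedModule_isHilbert (R : realType) (A : cstarType R)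
    X of CompleteNormedModule R[i] X := {
  rightact : X -> A -> X ;
  inner : X -> X -> A ;
  rightact_linearl : forall (k : R[i]) x y a,
    rightact (k *: x + y) a = k *: rightact x a + rightact y a ;
  rightact_linearr : forall (k : R[i]) x a b,
    rightact x (k *: a + b) = k *: rightact x a + rightact x b ;
  rightactM : forall x a b, rightact x (a ** b) = rightact (rightact x a) b ;
  inner_linearr : forall (k : R[i]) x y z,
    inner x (k *: y + z) = k *: inner x y + inner x z ;
  inner_rightact : forall x y a, inner x (rightact y a) = inner x y ** a ;
  inner_star : forall x y, (inner x y)^^* = inner y x ;
  inner_ge0 : forall x, cpositive (inner x x) ;
  inner_eq0 : forall x, inner x x = 0 -> x = 0 ;
  inner_norm : forall x, `|x| ^+ 2 = `|inner x x|
}.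

#[short(type="hilbertModType")]
HB.structure Definition HilbertModule (R : realType) (A : cstarType R) :=
  {X of CompleteNormedModule R[i] X & CompleteNormedModule_isHilbert R A X}.

Definition adjoint_of {R : realType} {A : cstarType R} {X : hilbertModType A}
    (T T' : X -> X) :=
  forall x y : X, inner (T x) y = inner x (T' y) :> A.

(* [leftact] is phi : A -> L(X); an adjointable map is automatically linear,
   A-linear and bounded. *)
HB.mixin Record HilbertModule_isBimodule (R : realType) (A : cstarType R)
    X of HilbertModule R A X := {
  leftact : A -> X -> X ;
  leftact_linear : forall (k : R[i]) a b x,
    leftact (k *: a + b) x = k *: leftact a x + leftact b x ;
  leftactM : forall a b x, leftact (a ** b) x = leftact a (leftact b x) ;
  leftact_star : forall a, adjoint_of (leftact a) (leftact (a^^*))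
}.

#[short(type="hilbertBimodType")]
HB.structure Definition HilbertBimodule (R : realType) (A : cstarType R) :=
  {X of HilbertModule R A X & HilbertModule_isBimodule R A X}.

Section CuntzPimsner.
Context {R : realType} {A : cstarType R} (X : hilbertBimodType A).

Definition theta (x y : X) : X -> X := fun z => rightact x (inner y z : A).

Definition adjointable (T : X -> X) := exists T', adjoint_of T T'.

(* The closure of the span of the [theta x y] in the operator norm. *)
Definition compact_op : set (X -> X) :=
  [set T | adjointable T /\
    forall eps : R[i], 0 < eps ->
      exists2 S : X -> X,
        linspan [set U | exists x y, U = theta x y] S &
        forall z, `|T z - S z| <= eps * `|z| ].

Definition J_ideal : set A := [set a | compact_op (leftact a)].

Record toeplitz (B : cstarType R) (psi : X -> B) (pi : A -> B) : Prop :=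
  Toeplitz {
  toeplitz_linear : linear psi ;
  toeplitz_hom : starhom pi ;
  toeplitz_rightact : forall x a, psi (rightact x a) = psi x ** pi a ;
  toeplitz_inner : forall x y, (psi x)^^* ** psi y = pi (inner x y) ;
  toeplitz_leftact : forall a x, psi (leftact a x) = pi a ** psi x
}.

(* [pi1_of psi rho]: on K(X), [rho] is the *-homomorphism pi^(1). *)
Record pi1_of (B : cstarType R) (psi : X -> B) (rho : (X -> X) -> B) : Prop :=
  Pi1Of {
  pi1_linear : forall (k : R[i]) T S, compact_op T -> compact_op S ->
    rho (fun z => k *: T z + S z) = k *: rho T + rho S ;
  pi1M : forall T S, compact_op T -> compact_op S ->
    rho (T \o S) = rho T ** rho S ;
  pi1_star : forall T T', compact_op T -> adjoint_of T T' ->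
    rho T' = (rho T)^^* ;
  pi1_theta : forall x y, rho (theta x y) = psi x ** (psi y)^^*
}.

(* Since pi^(1) exists and is unique (a *-homomorphism is continuous), it makes
   no difference whether it is quantified existentially or universally. *)
Definition cp_covariant (B : cstarType R) (psi : X -> B) (pi : A -> B) :=
  exists rho, pi1_of psi rho /\ forall a, J_ideal a -> rho (leftact a) = pi a.

Record universal_cp_rep (O : cstarType R) (kX : X -> O) (kA : A -> O) : Prop :=
  UniversalCPRep {
  ucp_toeplitz : toeplitz kX kA ;
  ucp_covariant : cp_covariant kX kA ;
  ucp_generated : cstar_gen (range kX `|` range kA) = setT ;
  ucp_universal : forall (B : cstarType R) (psi : X -> B) (pi : A -> B),
    toeplitz psi pi -> cp_covariant psi pi ->
    exists! h : O -> B, [/\ starhom h, forall x, h (kX x) = psi x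
      & forall a, h (kA a) = pi a]
}.

End CuntzPimsner.

Section UltragraphBimodule.
Context {R : realType} {G : ultragraph} {C : cstarType R}.
Variables (s : edge G -> C) (p : set (vertex G) -> C).

(* [iA] identifies A with the C*-subalgebra of C generated by the p_A. *)
Record ultragraph_coef (A : cstarType R) (iA : A -> C) : Prop :=
  UltragraphCoef {
  coef_hom : starhom iA ;
  coef_inj : injective iA ;
  coef_range : range iA = cstar_gen (p @` @gsets G)
}.

(* [iX] identifies X with the closed span of the s_e p_A in C, the operations
   of X being those of C. *)
Record ultragraph_bimodule (A : cstarType R) (iA : A -> C)
    (X : hilbertBimodType A) (iX : X -> C) : Prop := UltragraphBimodule {
  bimod_linear : linear iX ;
  bimod_inj : injective iX ;
  bimod_range : range iX =
    closure (linspan [set c | exists e B, gsets B /\ c = s e ** p B]) ;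
  bimod_rightact : forall x a, iX (rightact x a) = iX x ** iA a ;
  bimod_leftact : forall a x, iX (leftact a x) = iA a ** iX x ;
  bimod_inner : forall x y, iA (inner x y) = (iX x)^^* ** iX y
}.

End UltragraphBimodule.

(* Main.v *)
Require Import Defs.
From HB Require Import structures.
From mathcomp Require Import all_boot all_order all_algebra.
From mathcomp Require Import all_classical all_reals all_analysis.
From mathcomp Require Import ring lra.

(** Two universal properties are compared.  For one direction, the generators of
    O_X attached to the s_e and p_A form a Cuntz-Krieger family, because all
    relations except the one at finite emitters live in the bimodule, and that
    one is covariance: at a finite emitter v the left action of p_v on X is the
    finite-rank operator that sums the Theta_{s_e,s_e}.  For the other
    direction, the inclusions of X and A in the C*-algebra C of the ultragraph
    form a Toeplitz representation, and it has to be shown covariant.  The two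
    homomorphisms so obtained are mutually inverse by uniqueness, once one knows
    that *-homomorphisms are continuous, so that equalities pass from the s_e
    p_A to X and from the p_A to A.

    Covariance of the inclusion.  Let D be the closed span of the x y^* with x
    and y in X.  A compact operator T on X is left multiplication by a unique
    element of D ([compact_lift], [compacts_uniq]), which defines pi^(1); the
    limit exists because an element of finite rank is bounded in norm by the
    operator it induces on X ([finite_rank_bound]).  What remains is that a in A
    lies in D as soon as it acts compactly ([J_ideal_compacts]).  Such an a is
    close to a step element, a combination of the p_B with an attached step
    function on vertices, and its compact action is close to an element d' of C
    that kills s_e for all e outside a finite set F.  Testing on s_e shows that
    the step function is small at every vertex that emits an edge outside F.
    The other vertices are finitely many and, in the absence of sinks, finite
    emitters, so their p_v are in D; subtracting them leaves a step element
    whose step function is uniformly small, hence which is small in norm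
    ([step_elt_bound]).  So a is a limit of elements of D.

    Testing on s_e needs s_e to be nonzero.  By universality it is enough to
    have one family in which it is ([universal_edge_neq0]); it is realized on
    the square-summable functions on infinite paths, where s_e prepends e.  This
    is where the C*-algebra of bounded operators on a Hilbert space is built.

    C*-algebra theory is kept elementary and without units.  Norm estimates come
    from comparing dyadic powers of selfadjoint elements ([root_bound]).
    Continuity of *-homomorphisms ([starhom_contractive],
    [starhom_isometric]) and the fact that q <= p means p q = q for projections
    ([cle_projection_mul]) come from writing a small selfadjoint element as the
    real part of a unitary ([quasi_unitary]); its imaginary part is a square
    root, found as the fixed point of a contraction ([contractive_sqrt]). *)

Set Implicit Arguments.
Unset Strict Implicit.
Unset Printing Implicit Defensive.
Import Order.TTheory GRing.Theory Num.Theory.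
Import numFieldNormedType.Exports.

Local Open Scope classical_set_scope.
Local Open Scope complex_scope.
Local Open Scope ring_scope.
Local Open Scope cstar_scope.

(** * Real-valued norms and completeness *)

Section RealNorm.
Context {R : realType}.

Definition modulus (k : R[i]) : R := complex.Re `|k|.

Lemma modulusE k : `|k| = (modulus k)%:C.
Proof. by rewrite /modulus RRe_real ?ger0_real ?normr_ge0. Qed.

Lemma modulus_ge0 k : 0 <= modulus k.
Proof. by rewrite -lecR -modulusE normr_ge0. Qed.

Lemma modulusM k l : modulus (k * l) = modulus k * modulus l.
Proof. by apply: complexI; rewrite rmorphM /= -!modulusE normrM. Qed.

Lemma modulusD k l : modulus (k + l) <= modulus k + modulus l.
Proof. by rewrite -lecR rmorphD /= -!modulusE ler_normD. Qed.

Lemma modulus_real (t : R) : modulus t%:C = `|t|.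
Proof. by rewrite /modulus normc_def /= expr0n addr0 sqrtr_sqr. Qed.

Lemma conj_realC (t : R) : (t%:C)^* = t%:C :> R[i].
Proof. by rewrite conj_Creal // complex_real. Qed.

Lemma modulusi : modulus 'i = 1.
Proof. by rewrite /modulus normc_def /= expr0n add0r expr1n sqrtr1. Qed.

Lemma modulus_sqr (k : R[i]) : modulus k ^+ 2 = complex.Re k ^+ 2 + complex.Im k ^+ 2.
Proof. by apply: complexI; rewrite rmorphXn /= -modulusE add_Re2_Im2. Qed.

Lemma modulus_eq0 (k : R[i]) : modulus k = 0 -> k = 0.
Proof. by move=> k0; apply/normr0_eq0; rewrite modulusE k0. Qed.

Lemma modulus_sqrD (k l : R[i]) :
  modulus (k + l) ^+ 2 <= 2 * modulus k ^+ 2 + 2 * modulus l ^+ 2.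
Proof.
have : modulus (k + l) ^+ 2 <= (modulus k + modulus l) ^+ 2.
  by rewrite lerXn2r ?nnegrE ?addr_ge0 ?modulus_ge0 ?modulusD.
have := sqr_ge0 (modulus k - modulus l); lra.
Qed.

Lemma modulusN (k : R[i]) : modulus (- k) = modulus k.
Proof. by rewrite /modulus normrN. Qed.

Section Norm.
Variable V : normedModType R[i].

(** Norms of modules over R[i] are themselves in R[i]; their real parts live in an
    ordered field, where inequalities can be decided. *)
Definition nrm (x : V) : R := complex.Re `|x|.

Lemma nrmE x : `|x| = (nrm x)%:C.
Proof. by rewrite /nrm RRe_real ?ger0_real ?normr_ge0. Qed.

Lemma nrm_ge0 x : 0 <= nrm x.
Proof. by rewrite -lecR -nrmE normr_ge0. Qed.

Lemma nrm0 : nrm 0 = 0.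
Proof. by rewrite /nrm normr0. Qed.

Lemma nrm0_eq0 x : nrm x = 0 -> x = 0.
Proof. by move=> x0; apply/normr0_eq0; rewrite nrmE x0. Qed.

Lemma nrmN x : nrm (- x) = nrm x.
Proof. by rewrite /nrm normrN. Qed.

Lemma nrmC x y : nrm (x - y) = nrm (y - x).
Proof. by rewrite -nrmN opprB. Qed.

Lemma nrmD x y : nrm (x + y) <= nrm x + nrm y.
Proof. by rewrite -lecR rmorphD /= -!nrmE ler_normD. Qed.

Lemma nrmB x y : nrm (x - y) <= nrm x + nrm y.
Proof. by rewrite -(nrmN y) nrmD. Qed.

Lemma nrm_dist z x y : nrm (x - y) <= nrm (x - z) + nrm (z - y).
Proof. by rewrite -{1}(subrK z x) -addrA nrmD. Qed.

Lemma nrmZ k x : nrm (k *: x) = modulus k * nrm x.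
Proof. by apply: complexI; rewrite rmorphM /= -nrmE normrZ modulusE nrmE. Qed.

Lemma nrm_eq0_small x : (forall e : R, 0 < e -> nrm x <= e) -> x = 0.
Proof.
move=> h; apply: nrm0_eq0; apply/eqP; rewrite eq_le nrm_ge0 andbT.
by apply/ler_addgt0Pr => e e0; rewrite add0r h.
Qed.

Lemma closure_nrm (S : set V) x :
  closure S x <-> forall e : R, 0 < e -> exists2 y, S y & nrm (x - y) < e.
Proof.
split=> [clSx e e0|h U /nbhs_ballP[e /= e0 sub]].
  have /clSx[y [Sy]] : nbhs x (ball x e%:C).
    by apply: nbhsx_ballx; rewrite ltcR.
  by rewrite -ball_normE /= nrmE ltcR => xy; exists y.
have e0r : (complex.Re e)%:C = e by rewrite RRe_real ?gtr0_real.
have [|y Sy xy] := h (complex.Re e); first by rewrite -ltcR e0r.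
exists y; split=> //; apply: sub.
by rewrite -ball_normE /= nrmE -e0r ltcR.
Qed.

Lemma closed_nrm (S : set V) x : closed S ->
  (forall e : R, 0 < e -> exists2 y, S y & nrm (x - y) < e) -> S x.
Proof. by move=> cS h; apply: cS; apply/closure_nrm. Qed.

End Norm.

Lemma expr_lt_eps (t c e : R) : 0 <= t -> t < 1 -> 0 < e ->
  exists N, forall n, (N <= n)%N -> c * t ^+ n < e.
Proof.
move=> t0 t1 e0.
have : (fun n => c * t ^+ n) @ \oo --> (c * 0 : R).
  by apply: cvgMr; apply: cvg_expr; rewrite ger0_norm.
rewrite mulr0 => /cvgrPdist_lt /(_ _ e0)[N _ h]; exists N => n /h.
by rewrite /= sub0r normrN => /(le_lt_trans (ler_norm _)).
Qed.

Lemma geometric_tail (V : normedModType R[i]) (u : nat -> V) (c t : R) :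
  0 <= t -> t < 1 -> (forall n, nrm (u n.+1 - u n) <= c * t ^+ n) ->
  forall N k, (N <= k)%N -> nrm (u k - u N) <= c / (1 - t) * t ^+ N.
Proof.
move=> t0 t1 h.
have t1' : 0 < 1 - t by rewrite subr_gt0.
have tail N k : nrm (u (N + k)%N - u N) <= c / (1 - t) * (t ^+ N - t ^+ (N + k)).
  elim: k => [|k ih]; first by rewrite addn0 !subrr nrm0 mulr0.
  apply: (le_trans (nrm_dist (u (N + k)%N) _ _)).
  rewrite addnS; apply: (le_trans (lerD (h _) ih)).
  rewrite exprS le_eqVlt; apply/orP; left; apply/eqP; field.
  by rewrite lt0r_neq0.
have c0 : 0 <= c by have := h 0; rewrite expr0 mulr1; apply: le_trans (nrm_ge0 _).
have c1 : 0 <= c / (1 - t) by rewrite divr_ge0 // ltW.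
move=> N k /subnKC <-; apply: (le_trans (tail _ _)); apply: ler_wpM2l => //.
by rewrite gerBl exprn_ge0.
Qed.

Lemma geometric_cvg (V : completeNormedModType R[i]) (u : nat -> V) (c t : R) :
  0 <= t -> t < 1 -> (forall n, nrm (u n.+1 - u n) <= c * t ^+ n) ->
  exists l, forall e : R, 0 < e ->
    exists N, forall n, (N <= n)%N -> nrm (u n - l) < e.
Proof.
move=> t0 t1 h; have tail := geometric_tail t0 t1 h.
have cu : cauchy (u @ \oo).
  apply: cauchy_exP => e /= e0.
  have e0r : (complex.Re e)%:C = e by rewrite RRe_real ?gtr0_real.
  have e0' : 0 < complex.Re e by rewrite -ltcR e0r.
  have [N hN] := expr_lt_eps (c / (1 - t)) t0 t1 e0'.
  exists (u N); exists N => // k /= Nk; rewrite -ball_normE /= nrmE -e0r ltcR nrmC.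
  exact: le_lt_trans (tail _ _ Nk) (hN _ (leqnn _)).
have /cvg_ex[l /cvgrPdist_lt ul] : cvg (u @ \oo) by apply/cauchy_cvgP.
exists l => e e0; have [|N _ hN] := ul e%:C; first by rewrite ltcR.
by exists N => n /hN /=; rewrite nrmE ltcR nrmC.
Qed.

(** Choosing points in sets of the filter of geometrically decreasing diameter
    yields a sequence that carries its limit, so only such sequences matter. *)
Lemma complete_of_geometric (V : normedModType R[i]) :
  (forall u : nat -> V, (forall n, nrm (u n.+1 - u n) <= 2^-1 ^+ n) ->
    exists l, forall e : R, 0 < e ->
      exists N, forall n, (N <= n)%N -> nrm (u n - l) < e) ->
  forall F : set_system V, ProperFilter F -> cauchy F -> cvg F.
Proof.
move=> hV F FF /cauchyP cF.
have pos n : 0 < 2^-1 ^+ n / 4 :> R by rewrite divr_gt0 // exprn_gt0 // invr_gt0.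
have /choice[u Fu] n : exists x, F (ball x (2^-1 ^+ n / 4 : R)%:C).
  by apply: cF; rewrite ltcR.
have Fnrm n : F [set y | nrm (u n - y) < 2^-1 ^+ n / 4].
  apply: filterS (Fu n) => y; rewrite -ball_normE /= nrmE ltcR //.
have [|l hl] := hV u.
  move=> n; have [y [/= h1 h2]] := filter_ex (filterI (Fnrm n) (Fnrm n.+1)).
  have := nrm_dist y (u n.+1) (u n); rewrite (nrmC y (u n)).
  move: h1 h2 (pos n); rewrite exprS; lra.
apply/cvg_ex; exists l; apply/fcvgrPdist_lt => e e0.
have e0r : (complex.Re e)%:C = e by rewrite RRe_real ?gtr0_real.
have e0' : 0 < complex.Re e by rewrite -ltcR e0r.
have e2 : 0 < complex.Re e / 2 by rewrite divr_gt0.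
have [N1 h1] := hl _ e2.
have t0 : 0 <= 2^-1 :> R by rewrite invr_ge0.
have t1 : 2^-1 < 1 :> R by lra.
have [N2 h2] := expr_lt_eps 1 t0 t1 e2.
pose N := maxn N1 N2; apply: filterS (Fnrm N) => y /=.
rewrite nrmE -e0r ltcR => h3.
have := h1 N (leq_maxl _ _); have := h2 N (leq_maxr _ _).
have := nrm_dist (u N) l y; rewrite (nrmC l (u N)); move: h3 (pos N); lra.
Qed.

End RealNorm.

(** * Algebra and norms in C*-algebras *)

(** The terms below are noncommutative monomials, so sums of them are compared in the
    underlying abelian group: everything is moved to one side, where opposite terms
    are brought together and cancelled. *)
Ltac zmod_step :=
  match goal with
  | |- 0 + _ = 0 => rewrite add0r
  | |- ?x + (- ?x + _) = 0 => rewrite (addNKr x)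
  | |- - ?x + (?x + _) = 0 => rewrite (addKr x)
  | |- - ?x + ?s = 0 =>
     match s with context [?y + (x + ?t)] => rewrite (addrCA y x t) end
  | |- ?x + ?s = 0 =>
     match s with context [?y + (- x + ?t)] => rewrite (addrCA y (- x) t) end
  end.
Lemma eq_of_subr (V : zmodType) (u v : V) : u - v + 0 = 0 -> u = v.
Proof. by rewrite addr0 => /eqP; rewrite subr_eq0 => /eqP. Qed.

Ltac zmod_eq :=
  apply: eq_of_subr; rewrite ?(opprD, opprK, oppr0) -?addrA;
  repeat zmod_step; try reflexivity.

Section CStarTheory.
Context {R : realType} {A : cstarType R}.
Implicit Types (x y z a b w : A) (k : R[i]).

Lemma cmulDl x y z : (x + y) ** z = x ** z + y ** z.
Proof. by have := cmul_linearl 1 x y z; rewrite !scale1r. Qed.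

Lemma cmulDr x y z : x ** (y + z) = x ** y + x ** z.
Proof. by have := cmul_linearr 1 x y z; rewrite !scale1r. Qed.

Lemma cmul0l x : 0 ** x = 0.
Proof. by apply: (addrI (0 ** x)); rewrite -cmulDl !addr0. Qed.

Lemma cmul0r x : x ** 0 = 0.
Proof. by apply: (addrI (x ** 0)); rewrite -cmulDr !addr0. Qed.

Lemma cmulZl k x y : (k *: x) ** y = k *: (x ** y).
Proof. by have := cmul_linearl k x 0 y; rewrite cmul0l !addr0. Qed.

Lemma cmulZr k x y : x ** (k *: y) = k *: (x ** y).
Proof. by have := cmul_linearr k x y 0; rewrite cmul0r !addr0. Qed.

Lemma cmulNl x y : (- x) ** y = - (x ** y).
Proof. by rewrite -scaleN1r cmulZl scaleN1r. Qed.

Lemma cmulNr x y : x ** (- y) = - (x ** y).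
Proof. by rewrite -scaleN1r cmulZr scaleN1r. Qed.

Lemma cmulBl x y z : (x - y) ** z = x ** z - y ** z.
Proof. by rewrite cmulDl cmulNl. Qed.

Lemma cmulBr x y z : x ** (y - z) = x ** y - x ** z.
Proof. by rewrite cmulDr cmulNr. Qed.

Lemma cmul_suml (I : Type) (r : seq I) (P : pred I) (F : I -> A) y :
  (\sum_(i <- r | P i) F i) ** y = \sum_(i <- r | P i) F i ** y.
Proof.
by elim/big_rec2: _ => [|i u v _ <-]; rewrite ?cmul0l ?cmulDl.
Qed.

Lemma starD x y : (x + y)^^* = x^^* + y^^*.
Proof. by have := star_semilinear 1 x y; rewrite rmorph1 !scale1r. Qed.

Lemma star0 : (0 : A)^^* = 0.
Proof. by apply: (addrI (0^^*)); rewrite -starD !addr0. Qed.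

Lemma starZ k x : (k *: x)^^* = k^* *: x^^*.
Proof. by have := star_semilinear k x 0; rewrite star0 !addr0. Qed.

Lemma starN x : (- x)^^* = - x^^*.
Proof. by apply: (addrI (x^^*)); rewrite -starD !subrr star0. Qed.

Lemma starB x y : (x - y)^^* = x^^* - y^^*.
Proof. by rewrite starD starN. Qed.

Definition cstarE := (cmulDl, cmulDr, cmulNl, cmulNr, cmulZl, cmulZr, cmul0l,
  cmul0r, starD, starN, starZ, @starM R A, @starK R A, star0, @cmulA R A).

Lemma nrmM x y : nrm (x ** y) <= nrm x * nrm y.
Proof. by rewrite -lecR rmorphM /= -!nrmE cnormM. Qed.

Lemma nrm_cstar x : nrm (x^^* ** x) = nrm x ^+ 2.
Proof. by apply: complexI; rewrite rmorphXn /= -!nrmE cnorm_star. Qed.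

Lemma nrm_star x : nrm (x^^*) = nrm x.
Proof.
suff le y : nrm y <= nrm (y^^*).
  by apply/eqP; rewrite eq_le le -{2}(starK x) le.
have [y0|y0] := eqVneq (nrm y) 0; first by rewrite y0 nrm_ge0.
rewrite -(@ler_pM2r _ (nrm y)) ?lt0r ?y0 ?nrm_ge0 //.
by rewrite -expr2 -nrm_cstar nrmM.
Qed.

Lemma nrm_cstarC x : nrm (x ** x^^*) = nrm x ^+ 2.
Proof. by rewrite -{1}(starK x) nrm_cstar nrm_star. Qed.

Lemma cstar_eq0 x : x^^* ** x = 0 -> x = 0.
Proof.
move=> x0; apply: nrm0_eq0; apply/eqP; rewrite -sqrf_eq0 -nrm_cstar x0.
by rewrite nrm0.
Qed.

Lemma nrm_projection_le1 x : projection x -> nrm x <= 1.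
Proof.
move=> [xx sx]; have : nrm x ^+ 2 = nrm x by rewrite -nrm_cstar sx xx.
by have := nrm_ge0 x; nra.
Qed.

(** The exponent is shifted by one, as there is no unit: [cpow x 0] is x. *)
Definition cpow x n := iter n (cmul x) x.

Lemma cpowS x n : cpow x n.+1 = x ** cpow x n. Proof. by []. Qed.

Lemma cpowD x m n : cpow x (m + n).+1 = cpow x m ** cpow x n.
Proof.
elim: m => [|m ih]; first by rewrite cpowS.
by rewrite addSn cpowS ih !cpowS cmulA.
Qed.

Lemma cpowSr x n : cpow x n.+1 = cpow x n ** x.
Proof. by rewrite -[n in LHS]addn0 cpowD. Qed.

Lemma nrm_cpow x n : nrm (cpow x n) <= nrm x ^+ n.+1.
Proof.
elim: n => [|n ih]; first by rewrite expr1.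
rewrite cpowS exprS; apply: (le_trans (nrmM _ _)).
by rewrite ler_wpM2l ?nrm_ge0.
Qed.

Lemma star_cpow x n : (cpow x n)^^* = cpow (x^^*) n.
Proof.
by elim: n => [//|n ih]; rewrite cpowSr starM ih.
Qed.

(** For selfadjoint elements the C*-identity makes the norm multiplicative under
    squaring. *)
Lemma nrm_cpow2 x n : x^^* = x -> nrm (cpow x (2 ^ n).-1) = nrm x ^+ (2 ^ n).
Proof.
move=> sx; elim: n => [|n ih]; first by rewrite expr1.
have e : (2 ^ n.+1).-1 = ((2 ^ n).-1 + (2 ^ n).-1).+1.
  have := expn_gt0 2 n; rewrite expnS; case: (2 ^ n)%N => // k _.
  by rewrite mul2n -addnn addSn addnS.
rewrite e cpowD -{1}sx -star_cpow nrm_cstar ih -exprM.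
by rewrite expnS mulnC.
Qed.

(** Taking roots removes a constant factor.  Together with [nrm_cpow2], an estimate of
    high powers up to a constant gives a sharp estimate of the norm. *)
Lemma root_bound (K r t : R) : 0 <= r -> 0 <= t ->
  (forall n, r ^+ (2 ^ n) <= K * t ^+ (2 ^ n)) -> r <= t.
Proof.
move=> r0 t0 h; rewrite leNgt; apply/negP => tr.
have r0' : 0 < r by exact: le_lt_trans tr.
have [|||N hN] := @expr_lt_eps _ (t / r) K 1.
- by rewrite divr_ge0.
- by rewrite ltr_pdivrMr // mul1r.
- exact: ltr01.
have := hN (2 ^ N)%N (ltnW (ltn_expl _ _)) => /(_ isT).
rewrite exprMn exprVn mulrA ltr_pdivrMr ?exprn_gt0 // mul1r.
by rewrite ltNge h.
Qed.

(** The elements X = x^* x and Y = y^* y annihilate each other, so the powers of X + Y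
    are sums of powers and have norm at most twice the power of m^2. *)
Lemma nrm_orthD x y (m : R) : 0 <= m -> x^^* ** y = 0 -> x ** y^^* = 0 ->
  nrm x <= m -> nrm y <= m -> nrm (x + y) <= m.
Proof.
move=> m0 xy0 xy0' xm ym.
have yx0 : y^^* ** x = 0 by rewrite -[LHS]starK starM starK xy0 star0.
have yx0' : y ** x^^* = 0 by rewrite -[LHS]starK starM starK xy0' star0.
suff : nrm (x + y) ^+ 2 <= m ^+ 2 by rewrite ler_pXn2r ?nnegrE ?nrm_ge0.
pose X := x^^* ** x; pose Y := y^^* ** y.
have e : (x + y)^^* ** (x + y) = X + Y.
  by rewrite !cstarE xy0 yx0 addr0 add0r.
have XY : X ** Y = 0 by rewrite /X /Y cmulA -(cmulA _ x) xy0' !cstarE.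
have YX : Y ** X = 0 by rewrite /X /Y cmulA -(cmulA _ y) yx0' !cstarE.
have pow n : cpow (X + Y) n = cpow X n + cpow Y n.
  elim: n => [//|n ih]; rewrite !cpowS ih !cstarE.
  have z (U V : A) : U ** V = 0 -> U ** cpow V n = 0.
    by move=> UV; case: n {ih} => [|n] //; rewrite cpowS cmulA UV cmul0l.
  by rewrite (z X Y) // (z Y X) // addr0 add0r.
rewrite -nrm_cstar e; apply: (@root_bound 2); rewrite ?nrm_ge0 ?exprn_ge0 //.
move=> n; rewrite -nrm_cpow2; last by rewrite /X /Y !cstarE.
rewrite pow; apply: (le_trans (nrmD _ _)).
have bd (U : A) : nrm U <= m ^+ 2 -> nrm (cpow U (2 ^ n).-1) <= (m ^+ 2) ^+ (2 ^ n).
  move=> Um; apply: (le_trans (nrm_cpow _ _)); rewrite prednK ?expn_gt0 //.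
  by rewrite lerXn2r ?nnegrE ?nrm_ge0 ?exprn_ge0.
rewrite mulrC mulrDr mulr1 lerD // bd // nrm_cstar lerXn2r ?nnegrE ?nrm_ge0 //.
Qed.

(** Here b is 1 - sqrt (1 - a).  The map u -> (a + u^2) / 2 preserves the ball of radius
    |a| and contracts it by the factor |a|; its iterates from 0 stay in M and commute
    with whatever commutes with a. *)
Lemma contractive_sqrt (M : set A) a : cstar_subalgebra M -> M a ->
  a^^* = a -> nrm a < 1 ->
  exists b, [/\ M b, b^^* = b, b + b = a + b ** b, nrm b <= nrm a
     & forall c, a ** c = c ** a -> b ** c = c ** b].
Proof.
move=> [cM M0 Mlin MM _] Ma sa a1; set t := nrm a in a1 *.
have t0 : 0 <= t by exact: nrm_ge0.
pose h : R[i] := (2^-1 : R)%:C.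
have hh (v : A) : h *: v + h *: v = v.
  rewrite -scalerDl /h -rmorphD /=.
  have -> : 2^-1 + 2^-1 = 1 :> R by lra.
  by rewrite rmorph1 scale1r.
have mh : modulus h = 2^-1 by rewrite modulus_real ger0_norm // invr_ge0.
pose F u := h *: (a + u ** u); pose u n := iter n F 0.
have uS n : u n.+1 = F (u n) by [].
have Mu n : M (u n).
  elim: n => // n ih; rewrite uS /F -[h *: _]addr0; apply: (Mlin) => //.
  by rewrite -[a]scale1r; apply: Mlin => //; exact: MM.
have su n : (u n)^^* = u n.
  elim: n => [|n ih]; rewrite ?star0 // uS /F !cstarE ih sa.
  by rewrite /h conj_realC.
have ut n : nrm (u n) <= t.
  elim: n => [|n ih]; first by rewrite nrm0.
  rewrite uS /F nrmZ mh; have := nrmD a (u n ** u n); have := nrmM (u n) (u n).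
  have := nrm_ge0 (u n); move: ih a1; rewrite -/t; nra.
have cu n c : a ** c = c ** a -> u n ** c = c ** u n.
  move=> ac; elim: n => [|n ih]; first by rewrite cmul0l cmul0r.
  by rewrite uS /F !cstarE ac -cmulA ih cmulA ih.
have sqB x y : x ** x - y ** y = x ** (x - y) + (x - y) ** y.
  rewrite !cstarE; zmod_eq.
have nsqB x y : nrm x <= t -> nrm y <= t ->
    nrm (x ** x - y ** y) <= 2 * t * nrm (x - y).
  move=> xt yt; rewrite sqB; apply: (le_trans (nrmD _ _)).
  have := nrmM x (x - y); have := nrmM (x - y) y; have := nrm_ge0 (x - y); nra.
have step n : nrm (u n.+1 - u n) <= t * t ^+ n.
  elim: n => [|n ih].
    rewrite uS /F /u /= cmul0l addr0 subr0 expr0 nrmZ mh -/t; lra.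
  rewrite [u n.+2]uS [X in _ - X]uS /F -scalerBr opprD addrACA subrr add0r.
  rewrite nrmZ mh exprS; have := nsqB _ _ (ut n.+1) (ut n).
  by have := nrm_ge0 (u n.+1 - u n); move: ih; nra.
have [b ub] := geometric_cvg t0 a1 step.
have near2 (e : R) : 0 < e -> exists n, nrm (u n - b) < e /\ nrm (u n.+1 - b) < e.
  by move=> /ub[N hN]; exists N; split; apply: hN.
have bt : nrm b <= t.
  apply/ler_addgt0Pr => e /near2[n [h1 _]].
  have := nrm_dist (u n) b 0; rewrite !subr0 nrmC; have := ut n; lra.
exists b; split=> //.
- apply: (closed_nrm cM) => e /near2[n [h1 _]].
  by exists (u n) => //; rewrite nrmC.
- apply/eqP; rewrite -subr_eq0; apply/eqP; apply: nrm_eq0_small => e e0.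
  have [|n [h1 _]] := near2 (e / 2); first by rewrite divr_gt0.
  apply: (le_trans (nrm_dist (u n) _ _)).
  rewrite -{1}(su n) -starB nrm_star (nrmC b); lra.
- apply/eqP; rewrite -subr_eq0; apply/eqP; apply: nrm_eq0_small => e e0.
  have [|n [h1 h2]] := near2 (e / 4); first by rewrite divr_gt0.
  have -> : b + b - (a + b ** b) =
      (b - u n.+1) + (b - u n.+1) + (u n ** u n - b ** b).
    have ae : a = u n.+1 + u n.+1 - u n ** u n by rewrite uS /F hh addrK.
    by rewrite [in LHS]ae; zmod_eq.
  have := nsqB _ _ (ut n) bt.
  have := nrmD ((b - u n.+1) + (b - u n.+1)) (u n ** u n - b ** b).
  have := nrmD (b - u n.+1) (b - u n.+1); rewrite (nrmC b).
  have := nrm_ge0 (u n - b); nra.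
- move=> c ac; apply/eqP; rewrite -subr_eq0; apply/eqP.
  apply: nrm_eq0_small => e e0.
  have d0 : 0 < e / 2 / (nrm c + 1).
    by rewrite !divr_gt0 // ltr_wpDl // nrm_ge0.
  have [n [h1 _]] := near2 _ d0.
  have -> : b ** c - c ** b = c ** (u n - b) - (u n - b) ** c.
    by rewrite !cstarE (cu n _ ac); zmod_eq.
  apply: (le_trans (nrmB _ _)).
  have := nrmM c (u n - b); have := nrmM (u n - b) c.
  move: h1; rewrite ltr_pdivlMr ?ltr_wpDl ?nrm_ge0 //.
  have := nrm_ge0 (u n - b); have := nrm_ge0 c; nra.
Qed.

End CStarTheory.

(** * Quasi-unitaries and *-homomorphisms *)

Section QuasiUnitary.
Context {R : realType} {A : cstarType R}.
Implicit Types (x y z a b w : A) (k : R[i]).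

(** In a unitization, b = 1 - sqrt (1 - a^2) makes a + i (1 - b) and a - i (1 - b)
    unitary.  They act isometrically on y, and a and 1 - b are their half-sum and,
    up to i, their half-difference. *)
Lemma quasi_unitary a b y : a^^* = a -> b^^* = b -> a ** b = b ** a ->
  b + b = a ** a + b ** b ->
  nrm (a ** y) <= nrm y /\ nrm (y - b ** y) <= nrm y.
Proof.
move=> sa sb ab be; have [c ce] : exists c, c = y - b ** y by exists (y - b ** y).
rewrite -ce.
have nk k : k^* = - k -> k * k = -1 -> nrm (a ** y + k *: c) = nrm y.
  move=> kJ kk; apply/eqP; rewrite -(@eqrXn2 _ 2) ?nrm_ge0 // -!nrm_cstar.
  apply/eqP; congr nrm; rewrite !cstarE kJ sa scalerA mulrN kk opprK scale1r !scaleNr.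
  have -> : y^^* ** a ** c = y^^* ** a ** y - y^^* ** a ** b ** y.
    by rewrite ce !cstarE.
  have -> : c^^* ** a ** y = y^^* ** a ** y - y^^* ** a ** b ** y.
    by rewrite ce !cstarE sb -(cmulA _ b a) -ab !cstarE.
  have -> : c^^* ** c = y^^* ** y - y^^* ** a ** a ** y.
    rewrite ce !cstarE sb -(cmulA _ b b) -(cmulA _ a a).
    have -> : b ** b = b + b - a ** a by rewrite be addrAC subrr add0r.
    by rewrite !cstarE; zmod_eq.
  by rewrite -addrA addKr; zmod_eq.
have n1 : nrm (a ** y + 'i *: c) = nrm y.
  by apply: nk; [exact: conjCi | rewrite -expr2 sqrCi].
have n2 : nrm (a ** y + (- 'i) *: c) = nrm y.
  by apply: nk; [rewrite rmorphN /= conjCi | rewrite mulrNN -expr2 sqrCi].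
rewrite scaleNr in n2; set d := 'i *: c in n1 n2.
have nd : nrm d = nrm c by rewrite nrmZ modulusi mul1r.
have m2 : modulus 2 = 2 :> R.
  by rewrite -(rmorph_nat (real_complex R)) modulus_real ger0_norm.
have two v : nrm (v + v) = 2 * nrm v :> R.
  by rewrite -mulr2n -scaler_nat nrmZ m2.
split.
- have := nrmD (a ** y + d) (a ** y - d); rewrite n1 n2.
  have -> : a ** y + d + (a ** y - d) = a ** y + a ** y by zmod_eq.
  rewrite two; lra.
- have := nrmB (a ** y + d) (a ** y - d); rewrite n1 n2.
  have -> : a ** y + d - (a ** y - d) = d + d by zmod_eq.
  rewrite two nd; lra.
Qed.

Lemma cstar_subalgebraT : cstar_subalgebra [set: A].
Proof. by split=> //; exact: closedT. Qed.

Lemma selfadjoint_quasi (M : set A) a : cstar_subalgebra M -> M a ->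
  a^^* = a -> nrm a < 1 ->
  exists b, [/\ M b, b^^* = b, a ** b = b ** a & b + b = a ** a + b ** b].
Proof.
move=> sM Ma sa a1; have [_ _ _ MM _] := sM.
have [||b [Mb sb be _ bc]] := contractive_sqrt sM (MM _ _ Ma Ma).
- by rewrite starM sa.
- have := nrmM a a; have := nrm_ge0 a; nra.
by exists b; split=> //; rewrite bc // cmulA.
Qed.

(** The operator 1 - a^2 is the square of the contraction 1 - b of [quasi_unitary].
    This is the form in which positivity of squares is used. *)
Lemma nrm_sub_sqr a y : a^^* = a -> nrm a < 1 -> nrm (y - a ** a ** y) <= nrm y.
Proof.
move=> sa a1; have [b [_ sb ab be]] := selfadjoint_quasi cstar_subalgebraT I sa a1.
have -> : y - a ** a ** y = (y - b ** y) - b ** (y - b ** y).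
  have -> : a ** a = b + b - b ** b by rewrite be addrK.
  by rewrite !cstarE; zmod_eq.
have [_ h1] := quasi_unitary y sa sb ab be.
have [_ h2] := quasi_unitary (y - b ** y) sa sb ab be.
exact: le_trans h1.
Qed.

End QuasiUnitary.

Lemma le_of_scaling (R : realType) (r s : R) : 0 <= r ->
  (forall t : R, 0 < t -> t * r < 1 -> t * s <= 1) -> s <= r.
Proof.
move=> r0 h; apply/ler_addgt0Pr => e e0.
have t0 : 0 < r + e by rewrite ltr_wpDl.
have := h (r + e)^-1; rewrite invr_gt0 => /(_ t0).
rewrite ![_^-1 * _]mulrC ltr_pdivrMr // mul1r ltrDl => /(_ e0).
by rewrite ler_pdivrMr // mul1r.
Qed.

Section StarHom.
Context {R : realType} {A B : cstarType R} (f : A -> B).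
Hypothesis hf : starhom f.

Lemma starhomZD k x y : f (k *: x + y) = k *: f x + f y.
Proof. by case: hf => h _ _; exact: h. Qed.

Lemma starhom0 : f 0 = 0.
Proof. by apply: (addrI (f 0)); have := starhomZD 1 0 0; rewrite !scale1r !addr0. Qed.

Lemma starhomD x y : f (x + y) = f x + f y.
Proof. by have := starhomZD 1 x y; rewrite !scale1r. Qed.

Lemma starhomZ k x : f (k *: x) = k *: f x.
Proof. by have := starhomZD k x 0; rewrite starhom0 !addr0. Qed.

Lemma starhomB x y : f (x - y) = f x - f y.
Proof. by rewrite addrC -scaleN1r starhomZD scaleN1r addrC. Qed.

Lemma starhomM x y : f (x ** y) = f x ** f y.
Proof. by case: hf. Qed.

Lemma starhomS x : f (x^^*) = (f x)^^*.
Proof. by case: hf. Qed.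

(** A *-homomorphism preserves the relations of [quasi_unitary], so it maps small
    selfadjoint elements to contractions, and the C*-identity does the rest. *)
Lemma starhom_contractive x : nrm (f x) <= nrm x.
Proof.
suff sab h : h^^* = h -> nrm (f h) <= nrm h.
  have : nrm (f x) ^+ 2 <= nrm x ^+ 2.
    by rewrite -!nrm_cstar -starhomS -starhomM sab // !cstarE.
  by rewrite ler_pXn2r // nnegrE nrm_ge0.
move=> sh; apply: le_of_scaling => [|t t0]; first exact: nrm_ge0.
have nt (D : cstarType R) (v : D) : t * nrm v = nrm (t%:C *: v).
  by rewrite nrmZ modulus_real gtr0_norm.
rewrite !nt -starhomZ; set a := t%:C *: h => t1.
have sa : a^^* = a by rewrite /a starZ sh conj_realC.
have [b [_ sb ab be]] := selfadjoint_quasi cstar_subalgebraT I sa t1.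
have [||||/= h1 _] := @quasi_unitary _ _ (f a) (f b) (f a).
- by rewrite -starhomS sa.
- by rewrite -starhomS sb.
- by rewrite -!starhomM ab.
- by rewrite -!starhomM -!starhomD be.
have : nrm (f a) ^+ 2 <= nrm (f a) by rewrite -nrm_cstar -{1}starhomS sa.
by have := nrm_ge0 (f a); nra.
Qed.

(** The element b attached to f a can be taken in the closed range, so the relations of
    [quasi_unitary] pull back along f. *)
Lemma starhom_isometric : injective f -> cstar_subalgebra (range f) ->
  forall x, nrm (f x) = nrm x.
Proof.
move=> fi sM x; apply/eqP; rewrite eq_le starhom_contractive /=.
suff sab h : h^^* = h -> nrm h <= nrm (f h).
  have : nrm x ^+ 2 <= nrm (f x) ^+ 2.
    by rewrite -!nrm_cstar -starhomS -starhomM sab // !cstarE.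
  by rewrite ler_pXn2r // nnegrE nrm_ge0.
move=> sh; apply: le_of_scaling => [|t t0]; first exact: nrm_ge0.
have nt (D : cstarType R) (v : D) : t * nrm v = nrm (t%:C *: v).
  by rewrite nrmZ modulus_real gtr0_norm.
rewrite !nt -starhomZ; set a := t%:C *: h => a1.
have sa : a^^* = a by rewrite /a starZ sh conj_realC.
have sfa : (f a)^^* = f a by rewrite -starhomS sa.
have [_ [[b _ <-] sb ab be]] := selfadjoint_quasi sM (imageT f a) sfa a1.
have [||||/= h1 _] := @quasi_unitary _ _ a b a => //; try apply: fi.
- by rewrite starhomS.
- by rewrite !starhomM.
- by rewrite !starhomD !starhomM.
have : nrm a ^+ 2 <= nrm a by rewrite -nrm_cstar sa.
by have := nrm_ge0 a; nra.
Qed.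

End StarHom.

Lemma starhom_comp (R : realType) (A B D : cstarType R) (f : A -> B) (g : B -> D) :
  starhom f -> starhom g -> starhom (g \o f).
Proof.
move=> hf hg; split=> /= [k x y|x y|x].
- by rewrite /= (starhomZD hf) (starhomZD hg).
- by rewrite /= (starhomM hf) (starhomM hg).
- by rewrite /= (starhomS hf) (starhomS hg).
Qed.

Lemma starhom_id (R : realType) (A : cstarType R) : starhom (@id A).
Proof. by split. Qed.

(** * The order on projections *)

Section ProjectionOrder.
Context {R : realType} {A : cstarType R}.
Implicit Types (x y z w p q r e g b : A).

Lemma nrm_projC_le e y : projection e -> nrm (y - e ** y) <= nrm y.
Proof.
move=> [ee se]; have : nrm (y - e ** y) ^+ 2 <= nrm y * nrm (y - e ** y).
  rewrite -nrm_cstar.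
  have -> : (y - e ** y)^^* ** (y - e ** y) = y^^* ** (y - e ** y).
    by rewrite !cstarE se -(cmulA _ e e) ee; zmod_eq.
  by rewrite (le_trans (nrmM _ _)) // nrm_star.
by have := nrm_ge0 (y - e ** y); have := nrm_ge0 y; nra.
Qed.

(** Since 1 + g is positive, z^* (1 + g) z = 0 forces (1 + g) z = 0.  For th < 1 the
    element 1 + th g has a square root m, and |m z|^2 = (1 - th) |z|^2; then th tends
    to 1. *)
Lemma neg_fixpoint g z : g^^* = g -> nrm g <= 1 ->
  z^^* ** z + z^^* ** g ** z = 0 -> z + g ** z = 0.
Proof.
move=> sg g1 zgz; apply: nrm_eq0_small => e e0.
have z0 := nrm_ge0 z.
(* n is sqrt (1 - th); the final bound is 3 n |z| *)
pose n : R := Num.min 2^-1 (e / 3 / (nrm z + 1)).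
have n0 : 0 < n.
  by rewrite lt_min invr_gt0 ltr0n !divr_gt0 // ltr_wpDl.
have n1 : n <= 2^-1 by rewrite ge_min lexx.
have ne : n * (3 * nrm z) <= e.
  have : n <= e / 3 / (nrm z + 1) by rewrite ge_min lexx orbT.
  rewrite ler_pdivlMr ?ltr_wpDl // ler_pdivlMr //; nra.
pose th : R := 1 - n ^+ 2.
have th0 : 0 <= th by rewrite /th; nra.
have thE : (1 - th)%:C = 1 - th%:C :> R[i] by rewrite rmorphB rmorph1.
pose a := - th%:C *: g.
have sa : a^^* = a by rewrite /a starZ sg rmorphN /= conj_realC.
have na : nrm a <= th.
  by rewrite /a scaleNr nrmN nrmZ modulus_real ger0_norm //; nra.
have a1 : nrm a < 1 by rewrite (le_lt_trans na) // /th; nra.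
have [b [_ sb be bn _]] := contractive_sqrt cstar_subalgebraT I sa a1.
have aE : a = b + b - b ** b by rewrite be addrK.
have [y yE] : exists y, y = z - b ** z by exists (z - b ** z).
have yb : z - a ** z = y - b ** y by rewrite yE aE !cstarE; zmod_eq.
have yy : y^^* ** y = (n ^+ 2)%:C *: (z^^* ** z).
  have -> : y^^* ** y = z^^* ** z - z^^* ** a ** z.
    by rewrite yE aE !cstarE sb; zmod_eq.
  have -> : n ^+ 2 = 1 - th by rewrite /th; ring.
  rewrite thE scalerBl scale1r /a !cstarE; congr (_ - _).
  have -> : z^^* ** g ** z = - (z^^* ** z) by apply/eqP; rewrite -addr_eq0 addrC zgz.
  by rewrite scaleNr scalerN opprK.
have ny : nrm y = n * nrm z.
  apply/eqP; rewrite -(@eqrXn2 _ 2) ?nrm_ge0 // ?mulr_ge0 ?(ltW n0) //.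
  by rewrite -nrm_cstar yy nrmZ modulus_real nrm_cstar exprMn ger0_norm ?sqr_ge0.
have -> : z + g ** z = (y - b ** y) + (1 - th)%:C *: (g ** z).
  rewrite -yb /a !cstarE thE scalerBl scale1r scaleNr opprK -addrA; congr (_ + _).
  by rewrite addrC subrK.
apply: (le_trans (nrmD _ _)); have := nrmB y (b ** y); have := nrmM b y.
have b1 : nrm b <= 1 by rewrite (le_trans bn) // ltW.
rewrite nrmZ modulus_real ger0_norm; last by rewrite /th; nra.
have -> : 1 - th = n ^+ 2 by rewrite /th; ring.
have gz : nrm (g ** z) <= nrm z by have := nrmM g z; nra.
have gz0 := nrm_ge0 (g ** z).
have y0 := nrm_ge0 y.
rewrite ny in y0 *; move: ne; nra.
Qed.

(** With e = - z z^*, also a projection, and z = x + i y in terms of selfadjoint x and y,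
    the sum x^2 + y^2 is - (r + e) / 2.  As squares are positive ([nrm_sub_sqr]), adding
    a small multiple of r + e to 1 gives a contraction.  But it expands r, because
    r e r is also positive, in the sense that |r - r e r| <= |r|. *)
Lemma neg_projection_eq0 r z : projection r -> z ** r = z ->
  z^^* ** z = - r -> r = 0.
Proof.
move=> [rr sr] zr zz.
pose e := - (z ** z^^*).
have pe : projection e.
  split; last by rewrite /e !cstarE.
  rewrite /e !cstarE opprK -(cmulA z) zz !cstarE zr //.
(* scaling by 1/4 makes the norms of x and y less than 1 *)
pose t : R[i] := (4^-1 : R)%:C.
pose x := t *: (z + z^^*); pose y := t *: ('i *: (z - z^^*)).
have tJ : t^* = t by exact: conj_realC.
have sx : x^^* = x by rewrite /x !cstarE tJ addrC.
have sy : y^^* = y.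
  rewrite /y !cstarE tJ; congr (_ *: _).
  by rewrite conjCi scaleNr -scalerN opprD opprK addrC.
have mt : modulus t = 4^-1 by rewrite modulus_real ger0_norm // invr_ge0.
have z1 : nrm z <= 1.
  have : nrm z ^+ 2 <= 1 by rewrite -nrm_cstar zz nrmN nrm_projection_le1.
  have := nrm_ge0 z; nra.
have x1 : nrm x < 1.
  by rewrite /x nrmZ mt; have := nrmD z z^^*; rewrite nrm_star; nra.
have y1 : nrm y < 1.
  by rewrite /y !nrmZ mt modulusi; have := nrmB z z^^*; rewrite nrm_star; nra.
have xy : x ** x + y ** y = (8^-1 : R)%:C *: (- (e + r)).
  have -> : y ** y = (t * t) *: - ((z - z^^*) ** (z - z^^*)).
    rewrite /y !cmulZl !cmulZr !scalerA scalerN -scaleNr; congr (_ *: _).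
    by rewrite -mulrN1 -sqrCi; ring.
  have -> : x ** x = (t * t) *: ((z + z^^*) ** (z + z^^*)).
    by rewrite /x cmulZl cmulZr scalerA.
  rewrite -scalerDr.
  have -> : (z + z^^*) ** (z + z^^*) - (z - z^^*) ** (z - z^^*)
     = - (e + r) + - (e + r).
    have -> : - (e + r) = z ** z^^* + z^^* ** z by rewrite zz /e opprD opprK.
    by rewrite !cstarE; zmod_eq.
  rewrite -mulr2n -scaler_nat scalerA; congr (_ *: _).
  rewrite /t -(rmorph_nat (real_complex R)) -!rmorphM /=; congr (_%:C); lra.
have rrC (v : A) : nrm (r ** v) <= nrm v.
  have := nrmM r v; have := nrm_projection_le1 (conj rr sr).
  by have := nrm_ge0 v; have := nrm_ge0 r; nra.
have n8 (v : A) : nrm ((8^-1 : R)%:C *: v) = 8^-1 * nrm v.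
  by rewrite nrmZ modulus_real ger0_norm ?invr_ge0.
have s8 (v : A) : (8^-1 : R)%:C *: (v + v) = (4^-1 : R)%:C *: v.
  rewrite -(mulr2n v) -(scaler_nat 2 v) scalerA -(rmorph_nat (real_complex R)) -rmorphM /=.
  by congr (_%:C *: _); lra.
have h1 : nrm (r + r + (8^-1 : R)%:C *: (e ** r + r)) <= 2 * nrm r.
  have -> : r + r + (8^-1 : R)%:C *: (e ** r + r)
      = (r - x ** x ** r) + (r - y ** y ** r).
    rewrite addrACA; congr (_ + _); rewrite -opprD -cmulDl xy cmulZl cmulNl scalerN.
    by rewrite opprK cmulDl rr.
  have := nrm_sub_sqr r sx x1; have := nrm_sub_sqr r sy y1.
  have := nrmD (r - x ** x ** r) (r - y ** y ** r); lra.
have h2 : nrm (r - r ** e ** r) <= nrm r.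
  have -> : r - r ** e ** r = r ** (r - e ** r) by rewrite !cstarE rr.
  exact: le_trans (rrC _) (nrm_projC_le _ pe).
have h3 : r + r + (4^-1 : R)%:C *: r =
  r ** (r + r + (8^-1 : R)%:C *: (e ** r + r)) + (8^-1 : R)%:C *: (r - r ** e ** r).
  rewrite -s8 !cmulDr !cstarE !rr -[RHS]addrA; congr (_ + _).
  rewrite -scalerDr; congr (_ *: _).
  by zmod_eq.
have h4 : nrm (r + r + (4^-1 : R)%:C *: r) = (2 + 4^-1) * nrm r.
  rewrite -mulr2n -scaler_nat -scalerDl -(rmorph_nat (real_complex R)) -rmorphD.
  by rewrite nrmZ modulus_real ger0_norm // addr_ge0 ?invr_ge0.
apply: nrm0_eq0; apply/eqP; rewrite eq_le nrm_ge0 andbT.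
have := nrmD (r ** (r + r + (8^-1 : R)%:C *: (e ** r + r)))
  ((8^-1 : R)%:C *: (r - r ** e ** r)).
rewrite -h3 h4 n8; have := rrC (r + r + (8^-1 : R)%:C *: (e ** r + r)); lra.
Qed.

(** p - q is the difference of the orthogonal pieces p (1 - q) and (1 - p) q. *)
Lemma nrm_projB_le1 p q : projection p -> projection q -> nrm (p - q) <= 1.
Proof.
move=> hp hq; have [pp sp] := hp; have [qq sq] := hq.
have pA x : x ** p ** p = x ** p by rewrite -cmulA pp.
have qA x : x ** q ** q = x ** q by rewrite -cmulA qq.
have -> : p - q = (p - p ** q) + (p ** q - q) by zmod_eq.
apply: nrm_orthD => //.
- by rewrite !cstarE sp sq !(pp, qq, pA, qA); zmod_eq.
- by rewrite !cstarE sp sq !(pp, qq, pA, qA); zmod_eq.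
- have -> : p - p ** q = (p - q ** p)^^* by rewrite !cstarE sp sq.
  rewrite nrm_star; apply: le_trans (nrm_projC_le _ hq) _.
  exact: nrm_projection_le1.
- rewrite nrmC; apply: le_trans (nrm_projC_le _ hp) _.
  exact: nrm_projection_le1.
Qed.

(** Positivity of p - q is only known as a factorization b^* b.  The element z = b q
    satisfies the hypothesis of [neg_fixpoint] with g = b b^*, from which p and q
    commute.  Then r = q - p q is a projection, and (b r)^* (b r) = - r. *)
Lemma cle_projection_mul p q : projection p -> projection q -> cle q p ->
  p ** q = q.
Proof.
move=> hp hq [b bE]; have [pp sp] := hp; have [qq sq] := hq.
have [d dE] : exists d, d = p - q by exists (p - q).
rewrite -dE in bE.
have pA x : x ** p ** p = x ** p by rewrite -cmulA pp.
have qA x : x ** q ** q = x ** q by rewrite -cmulA qq.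
have pqq : p ** q = q ** p ** q.
  have : b ** q + (b ** b^^*) ** (b ** q) = 0.
    apply: neg_fixpoint; first by rewrite !cstarE.
      rewrite nrm_cstarC -nrm_cstar -bE dE; exact: nrm_projB_le1.
    have -> : (b ** q)^^* ** (b ** q) = q ** d ** q by rewrite bE !cstarE sq.
    have -> : (b ** q)^^* ** (b ** b^^*) ** (b ** q) = q ** (d ** d) ** q.
      by rewrite bE !cstarE sq.
    by rewrite dE !cstarE !(pp, qq, pA, qA); zmod_eq.
  move/(congr1 (cmul b^^*)); rewrite cmul0r cmulDr.
  have -> : b^^* ** (b ** q) = d ** q by rewrite bE !cstarE.
  have -> : b^^* ** (b ** b^^* ** (b ** q)) = d ** d ** q by rewrite bE !cstarE.
  rewrite dE !cstarE !(pp, qq, pA, qA) => h.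
  apply/eqP; rewrite -subr_eq0 -{}h; apply/eqP; zmod_eq.
have qp : q ** p = p ** q.
  by rewrite pqq -{1}sq -{1}sp -starM pqq !cstarE sp sq.
have [r rE] : exists r, r = q - p ** q by exists (q - p ** q).
have pr : projection r.
  split; last by rewrite rE !cstarE sp sq qp.
  rewrite rE !cstarE !(pp, qq, pA, qA) -pqq -(cmulA p q p) qp cmulA pp.
  by rewrite ?qA; zmod_eq.
suff : r = 0 by rewrite rE; move/eqP; rewrite subr_eq0 => /eqP.
apply: (@neg_projection_eq0 r (b ** r)) => //.
  by rewrite -cmulA pr.1.
have -> : (b ** r)^^* ** (b ** r) = r ** d ** r by rewrite bE !cstarE pr.2.
have -> : r ** d = - r.
  rewrite dE rE !cstarE !(pp, qq, pA, qA) -(cmulA p q p) qp cmulA pp.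
  by zmod_eq.
by rewrite cmulNl pr.1.
Qed.

End ProjectionOrder.

Lemma cle_of_mul (R : realType) (A : cstarType R) (p q : A) :
  projection p -> projection q -> p ** q = q -> cle q p.
Proof.
move=> [pp sp] [qq sq] pq; exists (p - q).
have qp : q ** p = q by rewrite -{1}sq -{1}sp -starM pq sq.
by rewrite !cstarE sp sq pp qq pq qp; zmod_eq.
Qed.

(** * Sums over arbitrary index sets *)

Section Sums.
Context {R : realType} {I : choiceType}.
Implicit Types (a b c d : I -> R).

Definition summ a :=
  (forall i, 0 <= a i) /\ (\esum_(i in [set: I]) (a i)%:E < +oo)%E.

Definition ssum a : R := fine (\esum_(i in [set: I]) (a i)%:E).

Lemma esum_ssum a : summ a -> (\esum_(i in [set: I]) (a i)%:E)%E = (ssum a)%:E.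
Proof.
move=> [a0 aoo]; rewrite /ssum fineK // fin_numE; apply/andP; split.
  by rewrite gt_eqF // (lt_le_trans (ltNyr 0)) // esum_ge0 // => i _; rewrite lee_fin.
by rewrite lt_eqF.
Qed.

Lemma ssum_ge0 a : (forall i, 0 <= a i) -> 0 <= ssum a.
Proof. by move=> a0; apply/fine_ge0/esum_ge0 => i _; rewrite lee_fin. Qed.

Lemma summ_le a b : (forall i, 0 <= a i <= b i) -> summ b ->
  summ a /\ ssum a <= ssum b.
Proof.
move=> ab sb; have h : (\esum_(i in [set: I]) (a i)%:E <=
    \esum_(i in [set: I]) (b i)%:E)%E.
  by apply: le_esum => i _; rewrite lee_fin; case/andP: (ab i).
have sa : summ a.
  split; first by move=> i; case/andP: (ab i).
  exact: le_lt_trans h sb.2.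
by split=> //; move: h; rewrite (esum_ssum sa) (esum_ssum sb) lee_fin.
Qed.

Lemma summD a b : summ a -> summ b ->
  summ (fun i => a i + b i) /\ ssum (fun i => a i + b i) = ssum a + ssum b.
Proof.
move=> sa sb; have e : (\esum_(i in [set: I]) (a i + b i)%:E =
    (ssum a + ssum b)%:E)%E.
  under eq_esum do rewrite EFinD.
  rewrite esumD; last 2 first.
  - by move=> i _; rewrite lee_fin; exact: sa.1.
  - by move=> i _; rewrite lee_fin; exact: sb.1.
  by rewrite (esum_ssum sa) (esum_ssum sb) EFinD.
split; last by rewrite {1}/ssum e.
by split=> [i|]; [rewrite addr_ge0 // ?sa.1 ?sb.1 | rewrite e ltry].
Qed.

Lemma summ_fsum a (K : R) : (forall i, 0 <= a i) ->
  (forall J, finite_set J -> \sum_(i \in J) a i <= K) ->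
  summ a /\ ssum a <= K.
Proof.
move=> a0 h; have le : (\esum_(i in [set: I]) (a i)%:E <= K%:E)%E.
  apply: ge_ereal_sup => _ [J [fJ _] <-].
  by rewrite fsumEFin // lee_fin h.
have sa : summ a by split=> //; apply: le_lt_trans le _; rewrite ltry.
by split=> //; rewrite -lee_fin -esum_ssum.
Qed.

Lemma fsum_le_ssum a J : summ a -> finite_set J -> \sum_(i \in J) a i <= ssum a.
Proof.
move=> sa fJ; rewrite -lee_fin -esum_ssum // -fsumEFin //.
by apply: esum_ge; exists J.
Qed.

Lemma le_ssum a i : summ a -> a i <= ssum a.
Proof.
move=> sa; have := fsum_le_ssum sa (finite_set1 i).
by rewrite fsbig_set1.
Qed.

Lemma summZ a (t : R) : 0 <= t -> summ a ->
  summ (fun i => t * a i) /\ ssum (fun i => t * a i) = t * ssum a.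
Proof.
move=> t0 sa.
have le (s : R) b : 0 <= s -> summ b ->
    summ (fun i => s * b i) /\ ssum (fun i => s * b i) <= s * ssum b.
  move=> s0 sb; apply: summ_fsum => [i|J fJ].
    by rewrite mulr_ge0 // sb.1.
  by rewrite -mulr_fsumr ler_wpM2l // fsum_le_ssum.
have [st h] := le _ _ t0 sa; split=> //; apply/eqP; rewrite eq_le h /=.
have [->|tn0] := eqVneq t 0.
  by rewrite mul0r ssum_ge0 // => i; rewrite mul0r.
have t0' : 0 < t by rewrite lt0r tn0.
have [_] := le t^-1 _ (ltW (etrans (invr_gt0 t) t0')) st.
have -> : (fun i => t^-1 * (t * a i)) = a.
  by apply/funext => i; rewrite mulKf.
by rewrite ler_pdivlMl.
Qed.

Lemma summ0 : summ (fun=> 0) /\ ssum (fun=> 0) = 0.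
Proof.
have e : (\esum_(i in [set: I]) (0 : R)%:E = 0)%E by rewrite esum1.
by split; rewrite /ssum ?e //; split=> //; rewrite e ltry.
Qed.

Lemma ssum_delta (i0 : I) : summ (fun i => if i == i0 then 1 else 0).
Proof.
split=> [i|]; first by case: ifP.
have -> : (\esum_(i in [set: I]) (if i == i0 then 1 else 0 : R)%:E =
    \esum_(i in [set i0]) 1)%E.
  rewrite (esum_mkcond [set i0]); apply: eq_esum => i _.
  by case: eqP => [->|ne]; [rewrite mem_set | rewrite memNset].
by rewrite esum_set1 ?ltry ?lee_fin.
Qed.

Lemma ssum_sub a b c d : summ a -> summ b -> summ c -> summ d ->
  (forall i, a i - b i = c i - d i) -> ssum a - ssum b = ssum c - ssum d.
Proof.
move=> sa sb sc sd h; have [_ e1] := summD sa sd; have [_ e2] := summD sc sb.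
have : ssum a + ssum d = ssum c + ssum b.
  rewrite -e1 -e2; congr ssum; apply/funext => i; have := h i; lra.
lra.
Qed.

Lemma ssum_reindex (u v : I -> option I) a :
  (forall x y, u x = Some y <-> v y = Some x) -> summ a ->
  summ (fun x => if u x is Some y then a y else 0) /\
  ssum (fun x => if u x is Some y then a y else 0) =
  ssum (fun y => if v y is Some _ then a y else 0).
Proof.
move=> uv sa.
pose e x := odflt x (u x); pose P := [set x | u x != None].
pose Q := [set y | v y != None].
have key : (\esum_(x in [set: I]) (if u x is Some y then a y else 0)%:E =
    \esum_(y in [set: I]) (if v y is Some _ then a y else 0)%:E)%E.
  transitivity (\esum_(y in Q) (a y)%:E)%E; last first.
    rewrite (esum_mkcond Q); apply: eq_esum => y _.
    by case: ifPn; rewrite ?inE ?notin_setE /Q /=; case: (v y).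
  rewrite (@reindex_esum _ _ _ P Q e); last first.
    split.
    - move=> x; rewrite /P /Q /e /=; case ux: (u x) => [y|] //= _.
      by have /uv -> := ux.
    - move=> x x'; rewrite !inE /P /e /=.
      case ux: (u x) => [y|] //= _; case ux': (u x') => [y'|] //= _ yy.
      by move: ux ux'; rewrite yy => /uv h1 /uv; rewrite h1 => -[].
    - move=> y; rewrite /Q /=; case vy: (v y) => [x|] //= _.
      by move/uv: vy => ux; exists x; rewrite /P /e /= ux.
  rewrite (esum_mkcond P); apply: eq_esum => x _.
  by case: ifPn; rewrite ?inE ?notin_setE /P /e /=; case: (u x).
have [sb _] : summ (fun y => if v y is Some _ then a y else 0) /\
    ssum (fun y => if v y is Some _ then a y else 0) <= ssum a.
  apply: (summ_le _ sa) => y; have := sa.1 y.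
  by case: (v y) => [_|] ay; rewrite ?lexx ?ay.
split; last by rewrite /ssum key.
split=> [x|]; first by case: (u x) => // y; exact: sa.1.
by rewrite key; exact: sb.2.
Qed.

End Sums.

(** * The Hilbert space of square-summable families *)

Section Ell2Def.
Variables (R : realType) (I : choiceType).

Definition sqr_summable : {pred I -> R[i]} :=
  fun f => `[< summ (fun i => modulus (f i) ^+ 2) >].

Lemma sqr_summable_submod : submod_closed sqr_summable.
Proof.
split.
  apply/asboolP; suff -> : (fun i : I => modulus (0 : R[i]) ^+ 2) = fun=> 0.
    exact: summ0.1.
  by apply/funext => i; rewrite modulus_sqr expr0n addr0.
move=> k f g /asboolP sf /asboolP sg; apply/asboolP.
have k0 : 0 <= 2 * modulus k ^+ 2 by rewrite mulr_ge0 ?sqr_ge0.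
have [s1 _] := summZ k0 sf; have [s2 _] := summZ (ler0n R 2) sg.
apply: (summ_le _ (summD s1 s2).1).1 => i; rewrite sqr_ge0 /=.
apply: (le_trans (modulus_sqrD _ _)).
by rewrite modulusM exprMn mulrA.
Qed.

HB.instance Definition _ := GRing.isSubmodClosed.Build R[i] (I -> R[i])
  sqr_summable sqr_summable_submod.

Record ell2 := Ell2 { ell2_val :> I -> R[i] ; _ : ell2_val \in sqr_summable }.

HB.instance Definition _ := [isSub for ell2_val].
HB.instance Definition _ := [Choice of ell2 by <:].
HB.instance Definition _ := [SubChoice_isSubLmodule of ell2 by <:].

End Ell2Def.

Section Ell2.
Context {R : realType} {I : choiceType}.
Implicit Types (f g h : ell2 R I) (k : R[i]).

Lemma ell2P f g : (forall i, f i = g i) -> f = g.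
Proof. by move=> fg; apply/val_inj/funext. Qed.

Lemma ell2D f g i : (f + g) i = f i + g i. Proof. by []. Qed.
Lemma ell2N f i : (- f) i = - f i. Proof. by []. Qed.
Lemma ell2Z k f i : (k *: f) i = k * f i. Proof. by []. Qed.

Definition absq f i : R := modulus (f i) ^+ 2.

Lemma summ_absq f : summ (absq f).
Proof. exact: (asboolP _ (valP f)). Qed.

Definition repart f g i : R :=
  complex.Re (f i) * complex.Re (g i) + complex.Im (f i) * complex.Im (g i).

Lemma absqD f g i : absq (f + g) i = absq f i + absq g i + 2 * repart f g i.
Proof. by rewrite /absq /repart !modulus_sqr ell2D; case: (f i) (g i) => a b [c d] /=; ring. Qed.

Lemma absqN f i : absq (- f) i = absq f i.
Proof. by rewrite /absq ell2N modulusN. Qed.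

Lemma absqZ k f i : absq (k *: f) i = modulus k ^+ 2 * absq f i.
Proof. by rewrite /absq ell2Z modulusM exprMn. Qed.

Lemma repartN f g i : repart f (- g) i = - repart f g i.
Proof. by rewrite /repart ell2N; case: (f i) (g i) => a b [c d] /=; ring. Qed.

(** The real part of the inner product: for complex linear operators, adjointness with
    respect to it is the usual adjointness.  By polarization it is expressed by sums of
    nonnegative families. *)
Definition rinner f g : R := (ssum (absq (f + g)) - ssum (absq (f - g))) / 4.

(** The real inner product is the difference of the sums of any two summable families
    whose difference is its summand.  Its algebraic laws reduce to pointwise
    identities in this way. *)
Lemma rinnerE f g a b : summ a -> summ b ->
  (forall i, a i - b i = repart f g i) -> rinner f g = ssum a - ssum b.
Proof.
move=> sa sb ab; have four : 0 <= 4 :> R by [].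
have [s1 e1] := summZ four sa; have [s2 e2] := summZ four sb.
rewrite /rinner (ssum_sub (summ_absq _) (summ_absq _) s1 s2) => [|i].
  by rewrite e1 e2; lra.
rewrite !absqD absqN repartN; have := ab i; lra.
Qed.

Lemma rinner_pol f g :
  exists a b, [/\ summ a, summ b, forall i, a i - b i = repart f g i
    & rinner f g = ssum a - ssum b].
Proof.
have q0 : 0 <= 4^-1 :> R by rewrite invr_ge0.
have [s1 e1] := summZ q0 (summ_absq (f + g)).
have [s2 e2] := summZ q0 (summ_absq (f - g)).
have h i : 4^-1 * absq (f + g) i - 4^-1 * absq (f - g) i = repart f g i.
  by rewrite !absqD absqN repartN; lra.
by eexists; eexists; split; [exact: s1|exact: s2|exact: h|exact: rinnerE].
Qed.

Lemma rinnerC f g : rinner f g = rinner g f.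
Proof.
have [a [b [sa sb ab ->]]] := rinner_pol g f; apply: rinnerE => // i.
by rewrite ab /repart ![complex.Re (g i) * _]mulrC ![complex.Im (g i) * _]mulrC.
Qed.

Lemma rinnerDl f g h : rinner (f + g) h = rinner f h + rinner g h.
Proof.
have [a [b [sa sb ab ->]]] := rinner_pol f h.
have [c [d [sc sd cd ->]]] := rinner_pol g h.
have [s1 e1] := summD sa sc; have [s2 e2] := summD sb sd.
rewrite (rinnerE s1 s2) => [|i]; first by rewrite e1 e2; lra.
have := ab i; have := cd i; rewrite /repart ell2D.
by case: (f i) (g i) (h i) => ? ? [? ?] [? ?] /=; nra.
Qed.

Lemma rinnerZl k f h : rinner (k *: f) h = rinner f (k^* *: h).
Proof.
have [a [b [sa sb ab ->]]] := rinner_pol f (k^* *: h).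
apply: rinnerE => // i; rewrite ab /repart !ell2Z.
have -> : k^* = complex.Re k -i* complex.Im k by case: (k).
by case: k {ab} (f i) (h i) => ? ? [? ?] [? ?] /=; ring.
Qed.

Lemma rinnerZr (t : R) f h : rinner f (t%:C *: h) = t * rinner f h.
Proof.
have nn (s : R) : 0 <= s -> rinner f (s%:C *: h) = s * rinner f h.
  move=> s0; have [a [b [sa sb ab ->]]] := rinner_pol f h.
  have [s1 e1] := summZ s0 sa; have [s2 e2] := summZ s0 sb.
  rewrite mulrBr -e1 -e2; apply: rinnerE => // i.
  rewrite -mulrBr ab /repart ell2Z.
  by case: (f i) (h i) => ? ? [? ?] /=; ring.
have [t0|t0] := leP 0 t; first exact: nn.
have e : rinner f (t%:C *: h) + rinner f ((- t)%:C *: h) = 0.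
  rewrite rinnerC (rinnerC f) -rinnerDl -scalerDl -rmorphD subrr scale0r.
  have [s0 e0] := @summ0 R I.
  rewrite (rinnerE s0 s0) ?subrr // => i.
  by rewrite /repart /= !mul0r addr0.
by move: e; rewrite (nn (- t)) ?oppr_ge0 ?ltW // mulNr; lra.
Qed.

Lemma rinner_self f : rinner f f = ssum (absq f).
Proof.
have [s0 e0] := @summ0 R I.
rewrite (rinnerE (summ_absq f) s0) ?e0 ?subr0 // => i.
by rewrite subr0 /absq /repart modulus_sqr; ring.
Qed.

Lemma rinner_ge0 f : 0 <= rinner f f.
Proof. by rewrite rinner_self ssum_ge0 // => i; rewrite sqr_ge0. Qed.

Lemma rinner_eq0 f : rinner f f = 0 -> f = 0.
Proof.
rewrite rinner_self => f0; apply: ell2P => i; apply: modulus_eq0.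
have := le_ssum i (summ_absq f); rewrite f0 /absq.
by have := modulus_ge0 (f i); nra.
Qed.

Lemma rinnerDr f g h : rinner f (g + h) = rinner f g + rinner f h.
Proof. by rewrite rinnerC rinnerDl !(rinnerC f). Qed.

Lemma rinnerNr f g : rinner f (- g) = - rinner f g.
Proof. by have := rinnerZr (-1) f g; rewrite rmorphN rmorph1 scaleN1r mulN1r. Qed.

Lemma rinner0r f : rinner f 0 = 0.
Proof. by have := rinnerNr f 0; rewrite oppr0; lra. Qed.

Lemma rinnerZJ k f g : rinner f (k *: g) = rinner (k^* *: f) g.
Proof. by rewrite rinnerZl conjCK. Qed.

Lemma rinner_ext f g : (forall h, rinner h f = rinner h g) -> f = g.
Proof.
move=> fg; apply/eqP; rewrite -subr_eq0; apply/eqP/rinner_eq0.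
by rewrite rinnerDr rinnerNr fg subrr.
Qed.

Definition l2norm f : R := Num.sqrt (rinner f f).

Lemma l2norm_ge0 f : 0 <= l2norm f. Proof. exact: sqrtr_ge0. Qed.

Lemma l2norm_sqr f : l2norm f ^+ 2 = rinner f f.
Proof. by rewrite sqr_sqrtr // rinner_ge0. Qed.

Lemma l2norm_eq0 f : l2norm f = 0 -> f = 0.
Proof. by move=> f0; apply: rinner_eq0; rewrite -l2norm_sqr f0 expr0n. Qed.

Lemma cauchy_schwarz f g : rinner f g <= l2norm f * l2norm g.
Proof.
have [f0|f0] := eqVneq (l2norm f) 0.
  by rewrite f0 (l2norm_eq0 f0) mul0r rinnerC rinner0r.
have [g0|g0] := eqVneq (l2norm g) 0.
  by rewrite g0 (l2norm_eq0 g0) mulr0 rinner0r.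
have pf : 0 < l2norm f by rewrite lt0r f0 l2norm_ge0.
have pg : 0 < l2norm g by rewrite lt0r g0 l2norm_ge0.
have pfg : 0 < l2norm f * l2norm g by rewrite mulr_gt0.
have ZZ (t u : R) f' g' : rinner (t%:C *: f') (u%:C *: g') = t * u * rinner f' g'.
  by rewrite rinnerZr rinnerC rinnerZr (rinnerC g') mulrCA mulrA.
have := rinner_ge0 ((l2norm g)%:C *: f - (l2norm f)%:C *: g).
rewrite rinnerDr rinnerNr !(rinnerC (_ - _)) !rinnerDr !rinnerNr !ZZ.
rewrite (rinnerC g f) -!l2norm_sqr.
set x := l2norm f in pf pg pfg *; set y := l2norm g in pf pg pfg *.
move=> h; rewrite -(ler_pM2l pfg); nra.
Qed.

Lemma cauchy_schwarz_abs f g : `|rinner f g| <= l2norm f * l2norm g.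
Proof.
have e : l2norm (- g) = l2norm g.
  by rewrite /l2norm rinnerNr rinnerC rinnerNr opprK.
have := cauchy_schwarz f g; have := cauchy_schwarz f (- g).
by rewrite rinnerNr e ler_norml; lra.
Qed.

Lemma l2normD f g : l2norm (f + g) <= l2norm f + l2norm g.
Proof.
rewrite -(@ler_pXn2r _ 2) ?nnegrE ?addr_ge0 ?l2norm_ge0 //.
rewrite l2norm_sqr rinnerDl !rinnerDr (rinnerC g f) -!l2norm_sqr.
have := cauchy_schwarz f g; lra.
Qed.

Lemma l2normZ k f : l2norm (k *: f) = modulus k * l2norm f.
Proof.
rewrite /l2norm !rinner_self.
have [_] := summZ (sqr_ge0 (modulus k)) (summ_absq f).
have -> : (fun i => modulus k ^+ 2 * absq f i) = absq (k *: f).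
  by apply/funext => i; rewrite absqZ.
move=> ->; rewrite sqrtrM ?sqr_ge0 // sqrtr_sqr ger0_norm //.
exact: modulus_ge0.
Qed.

End Ell2.

(** If s is the tail of the geometric series, a - s increases and a + s decreases. *)
Lemma geometric_real (R : realType) (a : nat -> R) (c t : R) :
  0 <= t -> t < 1 -> (forall n, `|a n.+1 - a n| <= c * t ^+ n) ->
  exists l, forall n, `|a n - l| <= c / (1 - t) * t ^+ n.
Proof.
move=> t0 t1 h; have t1' : 0 < 1 - t by rewrite subr_gt0.
pose s n := c / (1 - t) * t ^+ n.
have sE n : s n.+1 = s n - c * t ^+ n.
  by rewrite /s exprS; field; rewrite lt0r_neq0.
have s0 n : 0 <= s n.
  rewrite mulr_ge0 ?exprn_ge0 // divr_ge0 ?(ltW t1') //.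
  by have := h 0%N; rewrite expr0 mulr1; apply: le_trans.
have up n k : a n - s n <= a (n + k)%N - s (n + k)%N.
  elim: k => [|k ih]; first by rewrite addn0.
  rewrite addnS (le_trans ih) // sE; have := h (n + k)%N; rewrite ler_norml; lra.
have dn n k : a (n + k)%N + s (n + k)%N <= a n + s n.
  elim: k => [|k ih]; first by rewrite addn0.
  rewrite addnS (le_trans _ ih) // sE; have := h (n + k)%N; rewrite ler_norml; lra.
pose A := [set a n - s n | n in [set: nat]].
have ub m : ubound A (a m + s m).
  move=> _ [n _ <-]; have := up n m; have := dn m n; rewrite addnC.
  have := s0 (n + m)%N; lra.
have sA : has_sup A by split; [exists (a 0%N - s 0%N), 0%N | exists (a 0%N + s 0%N)].
exists (sup A) => n; have h1 : sup A <= a n + s n by apply: ge_sup => //; case: sA.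
have h2 : a n - s n <= sup A by apply: ub_le_sup; [case: sA | exists n].
by rewrite -/(s n) ler_norml; lra.
Qed.

Section Ell2Complete.
Context {R : realType} {I : choiceType}.

Fact ell2_normD (f g : ell2 R I) : (l2norm (f + g))%:C <= (l2norm f)%:C + (l2norm g)%:C.
Proof. by rewrite -rmorphD lecR l2normD. Qed.

Fact ell2_normZ k (f : ell2 R I) : (l2norm (k *: f))%:C = `|k| * (l2norm f)%:C.
Proof. by rewrite l2normZ modulusE rmorphM. Qed.

Fact ell2_norm_eq0 (f : ell2 R I) : (l2norm f)%:C = 0 -> f = 0.
Proof. by move=> h; apply: l2norm_eq0; apply: complexI. Qed.

HB.instance Definition _ := @Lmodule_isNormed.Build R[i] (ell2 R I)
  (fun f => (l2norm f)%:C) ell2_normD ell2_normZ ell2_norm_eq0.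

Lemma nrm_ell2 (f : ell2 R I) : nrm f = l2norm f. Proof. by []. Qed.

Lemma ssum_absq_nrm (f : ell2 R I) : ssum (absq f) = nrm f ^+ 2.
Proof. by rewrite nrm_ell2 l2norm_sqr rinner_self. Qed.

(** The limit is taken coordinatewise; the bound on finite partial sums of the distance
    is independent of the finite set, so it passes to the whole sum. *)
Fact ell2_complete (F : set_system (ell2 R I)) : ProperFilter F -> cauchy F -> cvg F.
Proof.
move: F; apply: complete_of_geometric => u hu.
have t0 : 0 <= 2^-1 :> R by rewrite invr_ge0.
have t1 : 2^-1 < 1 :> R by lra.
have hu1 n : nrm (u n.+1 - u n) <= 1 * 2^-1 ^+ n by rewrite mul1r.
pose s n : R := 2 * 2^-1 ^+ n.
have two : 1 / (1 - 2^-1) = 2 :> R.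
  have -> : 1 - 2^-1 = 2^-1 :> R by lra.
  by rewrite div1r invrK.
have tail N k : (N <= k)%N -> nrm (u k - u N) <= s N.
  by move=> /(geometric_tail t0 t1 hu1); rewrite two.
have s0 n : 0 <= s n by rewrite mulr_ge0 ?exprn_ge0.
have comp (z : R[i]) : `|complex.Re z| <= modulus z /\ `|complex.Im z| <= modulus z.
  by split; rewrite -(@ler_pXn2r _ 2) ?nnegrE ?modulus_ge0 // real_normK
    ?num_real // modulus_sqr ?lerDl ?lerDr sqr_ge0.
have coord (f : ell2 R I) i : modulus (f i) <= nrm f.
  rewrite -(@ler_pXn2r _ 2) ?nnegrE ?modulus_ge0 ?nrm_ge0 //.
  by rewrite -ssum_absq_nrm; apply: (le_ssum i (summ_absq f)).
have /choice[l hl] i : exists l : R[i], forall n, modulus (u n i - l) ^+ 2 <= 2 * s n ^+ 2.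
  have [a ha] : exists a, forall n, `|complex.Re (u n i) - a| <= 1 / (1 - 2^-1) * 2^-1 ^+ n.
    apply: geometric_real => // n; apply: le_trans (hu1 n).
    apply: le_trans (coord _ i); apply: le_trans (comp _).1.
    by rewrite ell2D ell2N; case: (u n.+1 i) (u n i) => ? ? [? ?].
  have [b hb] : exists b, forall n, `|complex.Im (u n i) - b| <= 1 / (1 - 2^-1) * 2^-1 ^+ n.
    apply: geometric_real => // n; apply: le_trans (hu1 n).
    apply: le_trans (coord _ i); apply: le_trans (comp _).2.
    by rewrite ell2D ell2N; case: (u n.+1 i) (u n i) => ? ? [? ?].
  exists (a +i* b) => n; have := ha n; have := hb n; rewrite two -/(s n).
  have sq (x : R) : `|x| <= s n -> x ^+ 2 <= s n ^+ 2.
    by move=> xs; rewrite -(real_normK (num_real x)) lerXn2r ?nnegrE.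
  move=> /sq h1 /sq h2; rewrite modulus_sqr.
  by move: h1 h2; case: (u n i) => x y /=; lra.
have key n J : finite_set J -> \sum_(i \in J) modulus (u n i - l i) ^+ 2 <= 2 * s n ^+ 2.
  move=> fJ; apply/ler_addgt0Pr => e e0.
  (* m depends on J, but the bound obtained does not *)
  pose q : R := (size (finmap.enum_fset (fset_set J)))%:R.
  have [N hN] := @expr_lt_eps _ 2^-1 (32 * q) e t0 t1 e0.
  pose m := maxn n N.
  have b1 i : modulus (u n i - l i) ^+ 2 <= 2 * absq (u m - u n) i + 4 * s m ^+ 2.
    have := modulus_sqrD (u n i - u m i) (u m i - l i); rewrite subrKA.
    have -> : absq (u m - u n) i = modulus (u n i - u m i) ^+ 2.
      by rewrite /absq ell2D ell2N -modulusN opprB.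
    have := hl i m; lra.
  apply: (@le_trans _ _ (\sum_(i \in J) (2 * absq (u m - u n) i + 4 * s m ^+ 2))).
    by rewrite !fsbig_finite //=; apply: ler_sum.
  rewrite fsbig_split //= -mulr_fsumr; apply: lerD.
    rewrite ler_wpM2l //; apply: le_trans (fsum_le_ssum (summ_absq _) fJ) _.
    by rewrite ssum_absq_nrm lerXn2r ?nnegrE ?nrm_ge0 // tail // leq_maxl.
  rewrite fsbig_finite //= big_const_seq iter_addr_0 count_predT.
  rewrite -[X in X <= _]mulr_natr -/q; have := hN m (leq_maxr _ _).
  have : 0 <= 2^-1 ^+ m :> R by exact: exprn_ge0.
  have : 2^-1 ^+ m <= 1 :> R by apply: exprn_ile1 => //; lra.
  have : 0 <= q by exact: ler0n.
  rewrite /s; move: (2^-1 ^+ m) => y; clearbody q => q0 y1 y0.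
  have : 0 <= q * y * (1 - y) by rewrite !mulr_ge0 // subr_ge0.
  have : 0 <= q * y by rewrite mulr_ge0.
  nra.
have sq n : (fun i => u n i - l i) \in @sqr_summable R I.
  apply/asboolP; have [] := @summ_fsum _ _ (fun i => modulus (u n i - l i) ^+ 2)
    (2 * s n ^+ 2) (fun i => sqr_ge0 _) (key n) => //.
pose L := u 0%N - Ell2 (sq 0%N).
have Li i : L i = l i by rewrite ell2D ell2N /=; ring.
exists L => e e0; have [N hN] := @expr_lt_eps _ 2^-1 4 e t0 t1 e0.
exists N => n Nn.
have : nrm (u n - L) ^+ 2 <= 2 * s n ^+ 2.
  rewrite -ssum_absq_nrm.
  have -> : absq (u n - L) = (fun i => modulus (u n i - l i) ^+ 2).
    by apply/funext => i; rewrite /absq ell2D ell2N Li.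
  by have [] := @summ_fsum _ _ (fun i => modulus (u n i - l i) ^+ 2)
    (2 * s n ^+ 2) (fun i => sqr_ge0 _) (key n).
have := hN n Nn; have := nrm_ge0 (u n - L); rewrite /s.
have : 0 <= 2^-1 ^+ n :> R by exact: exprn_ge0.
move: (2^-1 ^+ n) (nrm _) => y x; nra.
Qed.

HB.instance Definition _ := Uniform_isComplete.Build (ell2 R I) ell2_complete.

End Ell2Complete.

(** * The C*-algebra of bounded adjointable operators *)

Section OpDef.
Variables (R : realType) (I : choiceType).
Notation H := (ell2 R I).

Definition adjoint_pair (T T' : H -> H) := forall f g, rinner (T f) g = rinner f (T' g).

(** The adjoint is required to exist, as for operators on Hilbert modules; this passes to
    compositions and to uniform limits. *)
Definition bounded_op : {pred H -> H} := fun T =>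
  `[< [/\ linear T, exists T', adjoint_pair T T'
      & exists K : R, forall f, nrm (T f) <= K * nrm f] >].

Lemma bounded_op_submod : submod_closed bounded_op.
Proof.
split.
  apply/asboolP; split.
  - by move=> k f g; rewrite scaler0 addr0.
  - by exists (fun=> 0) => f g; rewrite rinnerC !rinner0r.
  - by exists 0 => f; rewrite nrm0 mul0r.
move=> k T S /asboolP[lT [T' TT'] [K hK]] /asboolP[lS [S' SS'] [L hL]].
apply/asboolP; split.
- move=> a f g; have E h : (k *: T + S) h = k *: T h + S h by [].
  by rewrite !E lT lS !scalerDr !scalerA (mulrC k) addrACA.
- exists (fun g => T' (k^* *: g) + S' g) => f g.
  by rewrite rinnerDl rinnerZl TT' SS' rinnerDr.
- exists (modulus k * K + L) => f; apply: le_trans (nrmD _ _) _.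
  by rewrite mulrDl lerD // nrmZ -mulrA ler_wpM2l ?modulus_ge0.
Qed.

HB.instance Definition _ := GRing.isSubmodClosed.Build R[i] (H -> H)
  bounded_op bounded_op_submod.

Record bop := Bop { bop_val :> H -> H ; _ : bop_val \in bounded_op }.

HB.instance Definition _ := [isSub for bop_val].
HB.instance Definition _ := [Choice of bop by <:].
HB.instance Definition _ := [SubChoice_isSubLmodule of bop by <:].

End OpDef.

Section Operators.
Context {R : realType} {I : choiceType}.
Notation H := (ell2 R I).
Implicit Types (T S : bop R I) (f g : H).

Lemma bopP T S : (forall f, T f = S f) -> T = S.
Proof. by move=> TS; apply/val_inj/funext. Qed.

Lemma bopD T S f : (T + S) f = T f + S f. Proof. by []. Qed.
Lemma bopN T f : (- T) f = - T f. Proof. by []. Qed.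
Lemma bopZ k T f : (k *: T) f = k *: T f. Proof. by []. Qed.

Lemma bop_linear T : linear T.
Proof. by have /asboolP[] := valP T. Qed.

Lemma bop0 T : T 0 = 0.
Proof.
have := bop_linear T 1 0 0; rewrite !scale1r addr0.
by move=> /(congr1 (fun v => v - T 0)); rewrite addrK subrr.
Qed.

Lemma bop_scale T k f : T (k *: f) = k *: T f.
Proof. by have := bop_linear T k f 0; rewrite bop0 !addr0. Qed.

Definition opnorm T : R := sup [set nrm (T f) | f in [set f | nrm f <= 1]].

Lemma opnorm_has_sup T : has_sup [set nrm (T f) | f in [set f | nrm f <= 1]].
Proof.
have /asboolP[_ _ [K hK]] := valP T; split.
  by exists (nrm (T 0)), 0 => //=; rewrite nrm0.
exists `|K| => _ [f /= f1 <-]; apply: (le_trans (hK f)).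
have := ler_norm K; have := nrm_ge0 f; have := normr_ge0 K; nra.
Qed.

Lemma opnorm_ge0 T : 0 <= opnorm T.
Proof.
apply: (le_trans (nrm_ge0 (T 0))); apply: ub_le_sup.
  by case: (opnorm_has_sup T).
by exists 0 => //=; rewrite nrm0.
Qed.

Lemma opnorm_ub T f : nrm (T f) <= opnorm T * nrm f.
Proof.
have [f0|f0] := eqVneq (nrm f) 0.
  by rewrite (nrm0_eq0 f0) bop0 nrm0 mulr0.
have pf : 0 < nrm f by rewrite lt0r f0 nrm_ge0.
rewrite -ler_pdivrMr //.
have -> : nrm (T f) / nrm f = nrm (T ((nrm f)^-1%:C *: f)).
  by rewrite bop_scale nrmZ modulus_real gtr0_norm ?invr_gt0 // mulrC.
apply: ub_le_sup; first by case: (opnorm_has_sup T).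
exists ((nrm f)^-1%:C *: f) => //=.
by rewrite nrmZ modulus_real gtr0_norm ?invr_gt0 // mulVf.
Qed.

Lemma opnorm_le T (K : R) : 0 <= K -> (forall f, nrm (T f) <= K * nrm f) ->
  opnorm T <= K.
Proof.
move=> K0 hK; apply: ge_sup; first by case: (opnorm_has_sup T).
move=> _ [f /= f1 <-]; apply: (le_trans (hK f)); have := nrm_ge0 f; nra.
Qed.

Fact bop_normD T S : (opnorm (T + S))%:C <= (opnorm T)%:C + (opnorm S)%:C.
Proof.
rewrite -rmorphD lecR; apply: opnorm_le => [|f]; first by rewrite addr_ge0 ?opnorm_ge0.
by rewrite bopD mulrDl (le_trans (nrmD _ _)) // lerD ?opnorm_ub.
Qed.

Fact bop_normZ k T : (opnorm (k *: T))%:C = `|k| * (opnorm T)%:C.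
Proof.
have le l S : opnorm (l *: S) <= modulus l * opnorm S.
  apply: opnorm_le => [|f]; first by rewrite mulr_ge0 ?opnorm_ge0 ?modulus_ge0.
  by rewrite bopZ nrmZ -mulrA ler_wpM2l ?modulus_ge0 ?opnorm_ub.
rewrite modulusE -rmorphM; congr (_%:C); apply/eqP; rewrite eq_le le /=.
have [->|k0] := eqVneq k 0.
  by rewrite /modulus normr0 mul0r opnorm_ge0.
have mk : modulus k * modulus k^-1 = 1.
  by rewrite -modulusM mulfV // /modulus normr1.
have := le k^-1 (k *: T); rewrite scalerA mulVf // scale1r => h.
have := ler_wpM2l (modulus_ge0 k) h; by rewrite mulrA mk mul1r.
Qed.

Fact bop_norm_eq0 T : (opnorm T)%:C = 0 -> T = 0.
Proof.
move=> /complexI T0; apply: bopP => f; apply: nrm0_eq0.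
by apply/eqP; rewrite eq_le nrm_ge0 andbT; have := opnorm_ub T f; rewrite T0 mul0r.
Qed.

HB.instance Definition _ := @Lmodule_isNormed.Build R[i] (bop R I)
  (fun T => (opnorm T)%:C) bop_normD bop_normZ bop_norm_eq0.

Lemma nrm_bop T : nrm T = opnorm T. Proof. by []. Qed.

Lemma bop_adjoint T : exists T' : bop R I, adjoint_pair T T'.
Proof.
have /asboolP[lT [T' TT'] _] := valP T.
suff hT' : T' \in @bounded_op R I by exists (Bop hT').
apply/asboolP; split.
- move=> k f g; apply: rinner_ext => h.
  rewrite -TT' !rinnerDr rinnerZJ -bop_scale !TT'.
  by rewrite (rinnerZJ k).
- by exists T => f g; rewrite rinnerC -TT' rinnerC.
exists (opnorm T) => f; have [e|e] := eqVneq (nrm (T' f)) 0.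
  by rewrite e mulr_ge0 ?opnorm_ge0 ?nrm_ge0.
have pe : 0 < nrm (T' f) by rewrite lt0r e nrm_ge0.
rewrite -(ler_pM2l pe) -expr2 !nrm_ell2 l2norm_sqr -TT'.
apply: (le_trans (cauchy_schwarz _ _)); rewrite -!nrm_ell2.
by rewrite mulrA ler_wpM2r ?nrm_ge0 // mulrC opnorm_ub.
Qed.

Definition bop_star T : bop R I := projT1 (cid (bop_adjoint T)).

Lemma bop_starP T : adjoint_pair T (bop_star T).
Proof. by rewrite /bop_star; case: cid. Qed.

Lemma bop_star_unique T S : adjoint_pair T S -> bop_star T = S.
Proof.
move=> TS; apply: bopP => f; apply: rinner_ext => h.
by rewrite -TS -bop_starP.
Qed.

Fact bop_comp_subproof T S : (T : H -> H) \o S \in @bounded_op R I.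
Proof.
apply/asboolP; split.
- by move=> k f g; rewrite /= !bop_linear.
- exists (bop_star S \o bop_star T) => f g /=.
  by rewrite bop_starP bop_starP.
- exists (opnorm T * opnorm S) => f /=; apply: (le_trans (opnorm_ub _ _)).
  by rewrite -mulrA ler_wpM2l ?opnorm_ge0 ?opnorm_ub.
Qed.

Definition bop_comp T S : bop R I := Bop (bop_comp_subproof T S).

Lemma bop_compE T S f : bop_comp T S f = T (S f). Proof. by []. Qed.

Fact bop_compA x y z : bop_comp x (bop_comp y z) = bop_comp (bop_comp x y) z.
Proof. exact: bopP. Qed.

Fact bop_comp_linearl k x y z :
  bop_comp (k *: x + y) z = k *: bop_comp x z + bop_comp y z.
Proof. exact: bopP. Qed.

Fact bop_comp_linearr k x y z :
  bop_comp x (k *: y + z) = k *: bop_comp x y + bop_comp x z.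
Proof. by apply: bopP => f; rewrite bop_compE bopD bopZ bop_linear. Qed.

Fact bop_normM x y : `|bop_comp x y| <= `|x| * `|y|.
Proof.
rewrite !nrmE -rmorphM lecR !nrm_bop; apply: opnorm_le => [|f].
  by rewrite mulr_ge0 ?opnorm_ge0.
rewrite bop_compE (le_trans (opnorm_ub _ _)) // -mulrA.
by rewrite ler_wpM2l ?opnorm_ge0 ?opnorm_ub.
Qed.

Fact bop_starK x : bop_star (bop_star x) = x.
Proof.
by apply: bop_star_unique => f g; rewrite rinnerC -bop_starP rinnerC.
Qed.

Fact bop_star_semilinear k x y :
  bop_star (k *: x + y) = k^* *: bop_star x + bop_star y.
Proof.
apply: bop_star_unique => f g.
by rewrite !bopD !bopZ rinnerDl rinnerDr rinnerZl !bop_starP bop_scale.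
Qed.

Fact bop_starM x y : bop_star (bop_comp x y) = bop_comp (bop_star y) (bop_star x).
Proof. by apply: bop_star_unique => f g; rewrite !bop_compE !bop_starP. Qed.

Lemma opnorm_comp x y : opnorm (bop_comp x y) <= opnorm x * opnorm y.
Proof. by have := bop_normM x y; rewrite !nrmE -rmorphM lecR !nrm_bop. Qed.

Lemma opnorm_star_comp y : opnorm y ^+ 2 <= opnorm (bop_comp (bop_star y) y).
Proof.
set c := opnorm (bop_comp _ _); have c0 : 0 <= c by exact: opnorm_ge0.
rewrite -[leRHS]sqr_sqrtr // lerXn2r ?nnegrE ?opnorm_ge0 ?sqrtr_ge0 //.
apply: opnorm_le => [|f]; first exact: sqrtr_ge0.
rewrite -(@ler_pXn2r _ 2) ?nnegrE ?mulr_ge0 ?nrm_ge0 ?sqrtr_ge0 //.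
rewrite exprMn (sqr_sqrtr c0) !nrm_ell2 l2norm_sqr bop_starP.
apply: (le_trans (cauchy_schwarz _ _)); rewrite -!nrm_ell2.
have := ler_wpM2l (nrm_ge0 f) (opnorm_ub (bop_comp (bop_star y) y) f).
by rewrite bop_compE -/c; lra.
Qed.

Lemma bop_star_norm x : opnorm (bop_star x) = opnorm x.
Proof.
have le y : opnorm y <= opnorm (bop_star y).
  have [y0|y0] := eqVneq (opnorm y) 0; first by rewrite y0 opnorm_ge0.
  have py : 0 < opnorm y by rewrite lt0r y0 opnorm_ge0.
  rewrite -(ler_pM2r py) -expr2.
  exact: le_trans (opnorm_star_comp y) (opnorm_comp _ _).
by apply/eqP; rewrite eq_le le andbT; have := le (bop_star x); rewrite bop_starK.
Qed.

Fact bop_cnorm_star x : `|bop_comp (bop_star x) x| = `|x| ^+ 2.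
Proof.
rewrite !nrmE -rmorphXn; congr (_%:C); rewrite !nrm_bop.
apply/eqP; rewrite eq_le opnorm_star_comp andbT.
by apply: le_trans (opnorm_comp _ _) _; rewrite bop_star_norm expr2.
Qed.

(** Limits are taken pointwise, for the operators and for their adjoints, which form a
    sequence with the same steps. *)
Fact bop_complete (F : set_system (bop R I)) : ProperFilter F -> cauchy F -> cvg F.
Proof.
move: F; apply: complete_of_geometric => u hu.
have t0 : 0 <= 2^-1 :> R by rewrite invr_ge0.
have t1 : 2^-1 < 1 :> R by lra.
have pt (v : nat -> bop R I) : (forall n, nrm (v n.+1 - v n) <= 2^-1 ^+ n) ->
  exists L : H -> H, forall n f, nrm (v n f - L f) <= 3 * 2^-1 ^+ n * nrm f.
  move=> hv; have hvf f n : nrm (v n.+1 f - v n f) <= nrm f * 2^-1 ^+ n.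
    have -> : v n.+1 f - v n f = (v n.+1 - v n) f by [].
    apply: (le_trans (opnorm_ub _ _)); rewrite mulrC ler_wpM2l ?nrm_ge0 //.
  have /choice[L hL] f := geometric_cvg t0 t1 (hvf f).
  exists L => n f; have [f0|f0] := eqVneq (nrm f) 0.
    rewrite (nrm0_eq0 f0) nrm0 mulr0 bop0 sub0r nrmN.
    apply/ler_addgt0Pr => e e0; have [N hN] := hL 0 e e0.
    have := hN N (leqnn _); rewrite bop0 sub0r nrmN; lra.
  have e0 : 0 < 2^-1 ^+ n * nrm f.
    by rewrite mulr_gt0 ?exprn_gt0 ?invr_gt0 // lt0r f0 nrm_ge0.
  have [N hN] := hL f _ e0; pose m := maxn n N.
  have h1 := geometric_tail t0 t1 (hvf f) (leq_maxl n N : (n <= m)%N).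
  apply: (le_trans (nrm_dist (v m f) _ _)); rewrite nrmC.
  have -> : 3 * 2^-1 ^+ n * nrm f = nrm f / (1 - 2^-1) * 2^-1 ^+ n + 2^-1 ^+ n * nrm f.
    have -> : 1 - 2^-1 = 2^-1 :> R by lra.
    rewrite invrK; ring.
  by apply: lerD => //; apply/ltW/hN/leq_maxr.
have shu n : nrm (bop_star (u n.+1) - bop_star (u n)) <= 2^-1 ^+ n.
  have -> : bop_star (u n.+1) - bop_star (u n) = bop_star (u n.+1 - u n).
    rewrite [in RHS]addrC -[- u n]scaleN1r bop_star_semilinear.
    by rewrite rmorphN rmorph1 scaleN1r addrC.
  by rewrite nrm_bop bop_star_norm; exact: hu.
have [L hL] := pt _ hu; have [L' hL'] := pt _ shu.
have small (x : R) (c : R) : (forall n, x <= c * 2^-1 ^+ n) -> x <= 0.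
  move=> h; apply/ler_addgt0Pr => e e0; rewrite add0r.
  have [N hN] := expr_lt_eps c t0 t1 e0.
  exact: le_trans (h N) (ltW (hN N (leqnn _))).
have t2 n : 0 <= 2^-1 ^+ n :> R by exact: exprn_ge0.
have LL' : adjoint_pair L L'.
  move=> f g; apply/eqP; rewrite -subr_eq0 -normr_le0; apply: (small _
    (6 * (nrm f * nrm g))) => n.
  have -> : rinner (L f) g - rinner f (L' g) =
      rinner f (bop_star (u n) g - L' g) - rinner (u n f - L f) g.
    rewrite (rinnerC (_ - _)) !rinnerDr !rinnerNr -bop_starP.
    by rewrite (rinnerC g (L f)) (rinnerC g); lra.
  apply: (le_trans (ler_normB _ _)).
  have := cauchy_schwarz_abs f (bop_star (u n) g - L' g).
  have := cauchy_schwarz_abs (u n f - L f) g; rewrite -!nrm_ell2.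
  have := ler_wpM2l (nrm_ge0 f) (hL' n g); have := ler_wpM2r (nrm_ge0 g) (hL n f).
  lra.
have linL : linear L.
  move=> k f g; apply/eqP; rewrite -subr_eq0; apply/eqP/nrm0_eq0/eqP.
  rewrite eq_le nrm_ge0 andbT; apply: (small _
    (3 * nrm (k *: f + g) + (modulus k * (3 * nrm f) + 3 * nrm g))) => n.
  have -> : L (k *: f + g) - (k *: L f + L g) =
      (k *: (u n f - L f) + (u n g - L g)) - (u n (k *: f + g) - L (k *: f + g)).
    have alg (a b c d e : H) : e - (b + d) = (a - b + (c - d)) - (a + c - e).
      by zmod_eq.
    by rewrite bop_linear scalerBr; apply: alg.
  apply: (le_trans (nrmB _ _)); have := hL n (k *: f + g).
  have := nrmD (k *: (u n f - L f)) (u n g - L g); rewrite nrmZ.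
  have := ler_wpM2l (modulus_ge0 k) (hL n f); have := hL n g; lra.
have bL : L \in @bounded_op R I.
  apply/asboolP; split=> //; first by exists L'.
  exists (opnorm (u 0%N) + 3) => f; have := hL 0%N f; rewrite expr0.
  have := nrm_dist (u 0%N f) (L f) 0; rewrite !subr0 (nrmC (L f)).
  have := opnorm_ub (u 0%N) f; lra.
exists (Bop bL) => e e0; have [N hN] := expr_lt_eps 3 t0 t1 e0.
exists N => n /hN; apply: le_lt_trans; rewrite nrm_bop; apply: opnorm_le.
  by rewrite mulr_ge0.
by move=> f; exact: hL.
Qed.

HB.instance Definition _ := Uniform_isComplete.Build (bop R I) bop_complete.

HB.instance Definition _ := @CompleteNormedModule_isCStar.Build R (bop R I)
  bop_comp bop_star bop_compA bop_comp_linearl bop_comp_linearr bop_normM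
  bop_starK bop_star_semilinear bop_starM bop_cnorm_star.

End Operators.

(** * The representation on infinite paths *)

(** A partial injection together with its inverse. *)
Record pbij (I : choiceType) := PBij {
  fwd : I -> option I ;
  bwd : I -> option I ;
  pbijP : forall x y, fwd x = Some y <-> bwd y = Some x
}.

Definition pinv (I : choiceType) (u : pbij I) : pbij I :=
  @PBij I (bwd u) (fwd u) (fun x y => iff_sym (pbijP u y x)).

Section PartialBijectionOp.
Context {R : realType} {I : choiceType}.
Notation H := (ell2 R I).
Implicit Types (u : pbij I) (f g : H).

Fact pshift_subproof u f :
  (fun x => if fwd u x is Some y then f y else 0) \in @sqr_summable R I.
Proof.
apply/asboolP; have [sa _] := ssum_reindex (pbijP u) (summ_absq f).
apply: (summ_le _ sa).1 => x; rewrite sqr_ge0 /absq /=.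
by case: (fwd u x) => [y|] //; rewrite modulus_sqr expr0n addr0.
Qed.

Definition pshift u f : H := Ell2 (pshift_subproof u f).

Lemma pshiftE u f x : pshift u f x = if fwd u x is Some y then f y else 0.
Proof. by []. Qed.

Lemma pshift_adjoint u : adjoint_pair (pshift u) (pshift (pinv u)).
Proof.
move=> f g; have [a [b [sa sb ab ->]]] := rinner_pol f (pshift (pinv u) g).
have h i : a i - b i = repart f (pshift (pinv u) g) i by exact: ab.
have [sa1 ea1] := ssum_reindex (pbijP u) sa.
have [sb1 eb1] := ssum_reindex (pbijP u) sb.
rewrite (rinnerE sa1 sb1) => [|x].
  rewrite ea1 eb1.
  have restrict_summ (c : I -> R) : summ c -> summ (fun y => if bwd u y is Some _ then c y else 0).
    move=> sc; apply: (summ_le _ sc).1 => y; have := sc.1 y.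
    by case: (bwd u y) => [_|] cy; rewrite ?lexx ?cy.
  apply: ssum_sub => //; try exact: restrict_summ.
  move=> i; have := h i; rewrite /repart pshiftE /=.
  by case: (bwd u i) => [x|] //=; rewrite !mulr0 addr0 => ->; rewrite subrr.
rewrite /repart pshiftE; case ux: (fwd u x) => [y|] /=; last by rewrite !mul0r addr0 subrr.
by rewrite h /repart pshiftE /=; have /pbijP -> := ux.
Qed.

Fact pshift_bounded u : pshift u \in @bounded_op R I.
Proof.
apply/asboolP; split.
- move=> k f g; apply: ell2P => x; rewrite ell2D ell2Z !pshiftE.
  by case: (fwd u x) => [y|] //; rewrite mulr0 addr0.
- by exists (pshift (pinv u)); exact: pshift_adjoint.
exists 1 => f; rewrite mul1r -(@ler_pXn2r _ 2) ?nnegrE ?nrm_ge0 //.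
rewrite -!ssum_absq_nrm.
have [sa e] := ssum_reindex (pbijP u) (summ_absq f).
have -> : absq (pshift u f) = (fun x => if fwd u x is Some y then absq f y else 0).
  apply/funext => x; rewrite /absq pshiftE; case: (fwd u x) => //.
  by rewrite modulus_sqr expr0n addr0.
rewrite e; apply: (summ_le _ (summ_absq f)).2 => y; have := (summ_absq f).1 y.
by case: (bwd u y) => [_|] cy; rewrite ?lexx ?cy.
Qed.

Definition pbij_op u : bop R I := Bop (pshift_bounded u).

Lemma pbij_opE u f x : pbij_op u f x = if fwd u x is Some y then f y else 0.
Proof. by []. Qed.

Lemma star_pbij_op u : (pbij_op u)^^* = pbij_op (pinv u).
Proof. exact/bop_star_unique/pshift_adjoint. Qed.

Lemma bop_mulE (T S : bop R I) f : (T ** S) f = T (S f).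
Proof. by []. Qed.

Lemma pbij_op_starE u f x : ((pbij_op u)^^* : bop R I) f x = if bwd u x is Some y then f y else 0.
Proof. by rewrite star_pbij_op. Qed.

Lemma pbij_op_isometry u : partial_isometry (pbij_op u).
Proof.
apply: bopP => f; apply: ell2P => x; rewrite !bop_mulE !pbij_opE.
case ux: (fwd u x) => [y|] //.
by rewrite pbij_op_starE; have /pbijP -> := ux; rewrite pbij_opE ux.
Qed.

Lemma pbij_op_rangeE u f x :
  (pbij_op u ** (pbij_op u)^^*) f x = if fwd u x is Some _ then f x else 0.
Proof.
rewrite bop_mulE pbij_opE; case ux: (fwd u x) => [y|] //.
by rewrite pbij_op_starE; have /pbijP -> := ux.
Qed.

Lemma bop_sumE (J : Type) (r : seq J) (F : J -> bop R I) f x :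
  (\sum_(i <- r) F i) f x = \sum_(i <- r) F i f x.
Proof.
elim: r => [|i r ih]; first by rewrite !big_nil.
by rewrite !big_cons bopD ell2D ih.
Qed.

Fact delta_subproof (x0 : I) :
  (fun x => if x == x0 then 1 else 0) \in @sqr_summable R I.
Proof.
apply/asboolP; apply: (summ_le _ (ssum_delta x0)).1 => x.
rewrite sqr_ge0 /=; case: ifP => _; rewrite modulus_sqr /=; lra.
Qed.

Definition delta x0 : H := Ell2 (delta_subproof x0).

End PartialBijectionOp.

Section PathSpace.
Variable G : ultragraph.

Record ipath := IPath {
  pedge : nat -> edge G ;
  pedgeP : forall n, range_of (pedge n) (source (pedge n.+1))
}.

HB.instance Definition _ := gen_eqMixin ipath.
HB.instance Definition _ := gen_choiceMixin ipath.

Lemma ipath_ext (x y : ipath) : (forall n, pedge x n = pedge y n) -> x = y.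
Proof.
case: x y => x hx [y hy] /= /funext xy; case: _ / xy hy => hy.
by rewrite (Prop_irrelevance hx hy).
Qed.

Definition psource (x : ipath) := source (pedge x 0).

Definition ptail (x : ipath) : ipath := IPath (fun n => pedgeP x n.+1).

Fact pcons_subproof e x : range_of e (psource x) -> forall n,
  let c := fun n => if n is k.+1 then pedge x k else e in
  range_of (c n) (source (c n.+1)).
Proof. by move=> ex [|n] //=; exact: pedgeP. Qed.

Definition pcons e x (h : range_of e (psource x)) : ipath :=
  IPath (pcons_subproof h).

Definition cut e x := if pedge x 0 == e then Some (ptail x) else None.

Definition prepend e y :=
  if pselect (range_of e (psource y)) is left h then Some (pcons h) else None.

Fact edge_pbij_subproof e x y : cut e x = Some y <-> prepend e y = Some x.
Proof.
rewrite /cut /prepend; split.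
- case: eqP => // <- [<-]; case: pselect => [h|[]]; last exact: pedgeP.
  by congr Some; apply: ipath_ext => -[].
- case: pselect => // h [<-] /=; rewrite eqxx; congr Some.
  by apply: ipath_ext.
Qed.

Definition edge_pbij e : pbij ipath := PBij (edge_pbij_subproof e).

Definition restr (B : set (vertex G)) x := if `[< B (psource x) >] then Some x else None.

Fact set_pbij_subproof B x y : restr B x = Some y <-> restr B y = Some x.
Proof. by rewrite /restr; split; case: asboolP => // h [<-]; rewrite asboolT. Qed.

Definition set_pbij B : pbij ipath := PBij (set_pbij_subproof B).

(** Ranges are nonempty and no vertex is a sink, so a path can always be continued. *)
Lemma ipath_exists (hG : no_sinks G) e : exists x, pedge x 0 = e.
Proof.
have /choice[nx hnx] (d : edge G) : exists d', range_of d (source d').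
  by have [v dv] := range_of_neq0 d; have [d' /= d'v] := hG v; exists d'; rewrite d'v.
have h n : range_of (iter n nx e) (source (iter n.+1 nx e)) by exact: hnx.
by exists (IPath h).
Qed.

Context {R : realType}.
Notation T := (bop R ipath).

Definition path_edge e : T := pbij_op (edge_pbij e).
Definition path_set B : T := pbij_op (set_pbij B).

Lemma path_setE B f x : path_set B f x = if `[< B (psource x) >] then f x else 0.
Proof. by rewrite pbij_opE /= /restr; case: asboolP. Qed.

Lemma path_edgeE e f x : path_edge e f x = if pedge x 0 == e then f (ptail x) else 0.
Proof. by rewrite pbij_opE /= /cut; case: eqP. Qed.

Lemma path_edge_starE e f y : ((path_edge e)^^* : T) f y =
  if pselect (range_of e (psource y)) is left h then f (pcons h) else 0.
Proof. by rewrite pbij_op_starE /= /prepend; case: pselect. Qed.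

Lemma path_edge_rangeE e f x :
  (path_edge e ** (path_edge e)^^*) f x = if pedge x 0 == e then f x else 0.
Proof. by rewrite pbij_op_rangeE /= /cut; case: eqP. Qed.

Lemma path_set_mul B B' : path_set B ** path_set B' = path_set (B `&` B').
Proof.
apply: bopP => f; apply: ell2P => x; rewrite bop_mulE !path_setE.
by rewrite asbool_and; case: asboolP; case: asboolP.
Qed.

Lemma path_projection B : projection (path_set B).
Proof.
split; first by rewrite path_set_mul setIid.
by rewrite star_pbij_op; apply: bopP => f; exact: ell2P.
Qed.

(** Edges act by [prepend], sets of vertices by restriction to the paths that start in
    them.  Every path begins with exactly one edge, which gives the relation at finite
    emitters. *)
Lemma path_ck_family : ck_family path_edge path_set.
Proof.
split.
- by move=> e; exact: pbij_op_isometry.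
- move=> e f ef; have h : (path_edge e)^^* ** path_edge f = 0.
    apply: bopP => g; apply: ell2P => y; rewrite bop_mulE path_edge_starE.
    by case: pselect => // hy; rewrite path_edgeE /=; case: eqP.
  by rewrite cmulA -(cmulA _ _ (path_edge f)) h cmul0r cmul0l.
- by move=> A _; exact: path_projection.
- by apply: bopP => f; apply: ell2P => x; rewrite path_setE asboolF.
- by move=> A A' _ _; exact: path_set_mul.
- move=> A A' _ _; apply: bopP => f; apply: ell2P => x.
  rewrite !bopD bopN !ell2D ell2N !path_setE asbool_or asbool_and.
  case: asboolP => _; case: asboolP => _ /=; rewrite ?subr0 ?addr0 ?add0r //.
  by rewrite addrK.
- move=> e; apply: bopP => f; apply: ell2P => y; rewrite bop_mulE path_edge_starE.
  rewrite path_setE; case: pselect => h; last by rewrite asboolF.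
  rewrite asboolT // path_edgeE /= eqxx; congr (f _); exact: ipath_ext.
- move=> e; apply: cle_of_mul.
  + exact: path_projection.
  + split; last by rewrite starM starK.
    by rewrite cmulA [_ ** path_edge e]pbij_op_isometry.
  + have : path_set [set source e] ** path_edge e = path_edge e.
      apply: bopP => f; apply: ell2P => x; rewrite bop_mulE path_setE path_edgeE.
      case: eqP => [<-|_]; last by rewrite if_same.
      by rewrite asboolT.
    by rewrite cmulA => ->.
- move=> v _ fv; apply: bopP => f; apply: ell2P => x.
  rewrite fsbig_finite // bop_sumE path_setE.
  under eq_bigr do rewrite path_edge_rangeE.
  case: asboolP => hx.
    rewrite (bigD1_seq (pedge x 0)) ?finmap.fset_uniq ?in_fset_set ?inE //=.
    by rewrite eqxx big1 ?addr0 // => e /negPf; rewrite eq_sym => ->.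
  rewrite big_seq big1 // => e; rewrite in_fset_set // inE /= => ev.
  by case: eqP => // xe; case: hx; rewrite /psource xe.
Qed.

End PathSpace.

(** Relations of the universal family hold in the path representation, where s_e does
    not vanish on a path that starts with e. *)
Lemma universal_edge_neq0 (R : realType) (G : ultragraph) (hG : no_sinks G)
    (C : cstarType R) (s : edge G -> C) (p : set (vertex G) -> C) :
  universal_ck_family s p -> forall e, s e != 0.
Proof.
move=> hC e; have [h [[[hl _ _] hs _] _]] := uck_universal hC (@path_ck_family G R).
apply/eqP => se; have [x xe] := ipath_exists hG e.
have h0 : h 0 = 0.
  have := hl 1 0 0; rewrite !scale1r addr0 => /(congr1 (fun v => v - h 0)).
  by rewrite addrK subrr.
have := hs e; rewrite se h0 => /(congr1 (fun T : bop R (ipath G) => T (delta (ptail x)) x)).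
rewrite path_edgeE xe eqxx /= eqxx => /eqP.
by rewrite eq_sym oner_eq0.
Qed.

(** * Norms in the span of a lattice of projections *)

Section ProjectionLattice.
Context {R : realType} {T : Type} {C : cstarType R}.
Variables (L : set (set T)) (p : set T -> C).
Hypothesis L0 : L set0.
Hypothesis LI : setI_closed L.
Hypothesis LU : setU_closed L.
Hypothesis p_proj : forall U, L U -> projection (p U).
Hypothesis p0 : p set0 = 0.
Hypothesis pI : forall U V, L U -> L V -> p U ** p V = p (U `&` V).
Hypothesis pU : forall U V, L U -> L V -> p (U `|` V) = p U + p V - p (U `&` V).

Implicit Types (s : seq (R[i] * set T)) (U V B : set T).

Definition step_fun s (v : T) : R[i] :=
  \sum_(b <- s) if `[< b.2 v >] then b.1 else 0.

Definition step_elt s : C := \sum_(b <- s) b.1 *: p b.2.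

Definition in_lattice s := forall b, List.In b s -> L b.2.

Lemma in_lattice_cons b s : in_lattice (b :: s) -> L b.2 /\ in_lattice s.
Proof. by move=> h; split=> [|c cs]; apply: h; [left | right]. Qed.

Lemma in_lattice_cat s1 s2 : in_lattice s1 -> in_lattice s2 -> in_lattice (s1 ++ s2).
Proof.
move=> h1 h2; elim: s1 h1 => [//|b s1 ih] /in_lattice_cons[lb /ih h] c /= [<-|hc].
  exact: lb.
exact: (h _ hc).
Qed.

Lemma step_elt_comm s U : in_lattice s -> L U ->
  step_elt s ** p U = p U ** step_elt s.
Proof.
move=> ls lU; elim: s ls => [|b s ih] /=; first by rewrite /step_elt big_nil !cstarE.
move=> /in_lattice_cons[lb /ih]; rewrite /step_elt big_cons !cstarE => ->.
by rewrite !pI // setIC.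
Qed.

(** The projection p U - p V stands for the cell U minus V, which need not be in L.
    Each new set B splits the cell in two orthogonal ones, on which the step function
    has one term fewer, the coefficient of B being absorbed in the constant c; the
    norm of the sum is the larger of the two norms. *)
Lemma cell_bound s U V c (M : R) : in_lattice s -> L U -> L V -> V `<=` U ->
  0 <= M -> (forall v, U v -> ~ V v -> modulus (c + step_fun s v) <= M) ->
  nrm (c *: (p U - p V) + (p U - p V) ** step_elt s) <= M.
Proof.
move=> ls lU lV VU M0; elim: s U V c ls lU lV VU => [|[k B] s ih] U V c ls lU lV VU hM.
  rewrite /step_elt big_nil cmul0r addr0 nrmZ.
  have [[v [Uv nVv]]|no] := pselect (exists v, U v /\ ~ V v).
    have c1 : modulus c <= M.
      by have := hM v Uv nVv; rewrite /step_fun big_nil addr0.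
    have d1 : nrm (p U - p V) <= 1.
      have [pp sp] := p_proj lU; have [qq sq] := p_proj lV.
      apply: nrm_projection_le1; split; last by rewrite starB sp sq.
      rewrite !cstarE pp qq !pI // setIC setIidl //.
      by zmod_eq.
    by have := nrm_ge0 (p U - p V); have := modulus_ge0 c; nra.
  have -> : U = V.
    by apply/seteqP; split=> // v Uv; apply: contrapT => nVv; apply: no; exists v.
  by rewrite subrr nrm0 mulr0.
have [/= lB ls'] := in_lattice_cons ls.
have lUB := LI lU lB; have lVB := LI lV lB; have lW := LU lV lUB.
have VUB : V `&` B `<=` U `&` B by apply: setSI.
have WU : V `|` (U `&` B) `<=` U by rewrite subUset; split=> // v [].
have d1E : p (U `&` B) - p (V `&` B) = (p U - p V) ** p B.
  by rewrite cmulBl !pI.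
have d2E : p U - p (V `|` (U `&` B)) = (p U - p V) - (p U - p V) ** p B.
  rewrite -d1E pU // setIA (setIidl VU); zmod_eq.
have b1 : nrm ((c + k) *: (p (U `&` B) - p (V `&` B)) +
    (p (U `&` B) - p (V `&` B)) ** step_elt s) <= M.
  apply: ih => // v [Uv Bv] nVB; have nV : ~ V v by move=> Vv; apply: nVB.
  by have := hM v Uv nV; rewrite /step_fun big_cons /= asboolT // addrA.
have b2 : nrm (c *: (p U - p (V `|` (U `&` B))) +
    (p U - p (V `|` (U `&` B))) ** step_elt s) <= M.
  apply: ih => // v Uv nW; have nV : ~ V v by move=> Vv; apply: nW; left.
  have nB : ~ B v by move=> Bv; apply: nW; right.
  by have := hM v Uv nV; rewrite /step_fun big_cons /= asboolF // add0r.
move: b1 b2; rewrite d1E d2E; set d := p U - p V; set e := step_elt s.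
have dB : d ** p B = p B ** d by rewrite /d cmulBl cmulBr !pI // ![B `&` _]setIC.
have de : e ** d = d ** e.
  by rewrite /d /e cmulBl cmulBr !step_elt_comm.
have eB : e ** p B = p B ** e by exact: step_elt_comm.
have [pp sp] := p_proj lU; have [qq sq] := p_proj lV; have [BB sB] := p_proj lB.
have dd : d ** d = d.
  rewrite /d !cstarE pp qq !pI // setIC (setIidl VU).
  by zmod_eq.
have sd : d^^* = d by rewrite /d starB sp sq.
have selt : step_elt ((k, B) :: s) = k *: p B + e by rewrite /step_elt big_cons.
rewrite selt; clearbody d e; set b := p B in dB eB BB sB *.
have [d1 d1E'] : exists d1, d1 = d ** b by exists (d ** b).
have [d2 d2E'] : exists d2, d2 = d - d1 by exists (d - d1).
rewrite -d1E' -d2E' => b1 b2.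
have d1d : d1 ** d = d1 by rewrite d1E' -cmulA -dB cmulA dd.
have d1d1 : d1 ** d1 = d1 by rewrite {2}d1E' cmulA d1d d1E' -cmulA BB.
have sd1 : d1^^* = d1 by rewrite d1E' starM sd sB dB.
have sd2 : d2^^* = d2 by rewrite d2E' starB sd sd1.
have d12 : d1 ** d2 = 0 by rewrite d2E' cmulBr d1d d1d1 subrr.
have d2d2 : d2 ** d2 = d2.
  by rewrite {1}d2E' cmulBl d12 subr0 d2E' cmulBr dd d1E' cmulA dd.
have d1e : e ** d1 = d1 ** e by rewrite d1E' cmulA de -cmulA eB cmulA.
have d2e : e ** d2 = d2 ** e by rewrite d2E' cmulBr cmulBl de d1e.
have corner (u : C) l : u ** u = u -> e ** u = u ** e ->
    let x := l *: u + u ** e in x = u ** x /\ x = x ** u.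
  move=> uu eu /=; rewrite cmulDr cmulDl cmulZr cmulZl uu cmulA uu.
  by rewrite -(cmulA u e) eu cmulA uu.
have [x1 x2] := corner d1 (c + k) d1d1 d1e; have [y1 y2] := corner d2 c d2d2 d2e.
set x := (c + k) *: d1 + d1 ** e in b1 x1 x2.
set y := c *: d2 + d2 ** e in b2 y1 y2.
have -> : c *: d + d ** (k *: b + e) = x + y.
  have alg (u1 u2 u3 u4 u5 : C) : u1 + (u2 + u3) = u4 + u2 + u5 + (u1 - u4 + (u3 - u5)).
    by zmod_eq.
  rewrite /x /y d2E' scalerBr cmulBl scalerDl cmulDr cmulZr -d1E'.
  exact: alg.
apply: nrm_orthD => //.
  by rewrite x1 y1 starM sd1 cmulA -(cmulA _ d1) d12 cmul0r cmul0l.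
by rewrite x2 y2 starM sd2 cmulA -(cmulA _ d1) d12 cmul0r cmul0l.
Qed.

(** Combinations of the p_B behave as if p were a spectral measure.  The union
    of the sets involved acts as a unit, so this is the case V = set0 of [cell_bound]. *)
Lemma step_elt_bound s (M : R) : in_lattice s -> 0 <= M ->
  (forall v, modulus (step_fun s v) <= M) -> nrm (step_elt s) <= M.
Proof.
move=> ls M0 hM.
have [U [lU sU]] : exists U, L U /\ forall b, List.In b s -> b.2 `<=` U.
  elim: s ls {hM} => [|b s ih]; first by exists set0.
  move=> /in_lattice_cons[lb /ih[U [lU sU]]]; exists (b.2 `|` U); split; first exact: LU.
  move=> c [<-|/sU cU]; first exact: subsetUl.
  exact: subset_trans cU (@subsetUr _ _ _).
have Ue : p U ** step_elt s = step_elt s.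
  elim: s ls {hM} sU => [|b s ih] /=; first by rewrite /step_elt big_nil cmul0r.
  move=> /in_lattice_cons[lb /ih] ih' sU.
  rewrite /step_elt big_cons cmulDr cmulZr pI // setIC setIidl; last by apply: sU; left.
  by rewrite ih' // => c cs; apply: sU; right.
have := @cell_bound s U set0 0 M ls lU L0 (@sub0set _ _) M0.
rewrite scale0r add0r p0 subr0 Ue; apply=> v _ _; rewrite add0r; exact: hM.
Qed.

End ProjectionLattice.

(** * Closed spans and Hilbert modules inside a C*-algebra *)

Section LinSpan.
Context {R : realType} {V : lmodType R[i]}.
Implicit Types (S : set V).

Lemma linspan_ind S (P : V -> Prop) : P 0 ->
  (forall k x y, S x -> P y -> P (k *: x + y)) -> forall v, linspan S v -> P v.
Proof.
move=> P0 PS v [n [k [x [Sx ->]]]].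
by elim/big_rec: _ => // i y _ Py; apply: PS.
Qed.

Lemma linspan0 S : linspan S 0.
Proof.
by exists 0%N, (fun=> 0), (fun=> 0); split; [case | rewrite big_ord0].
Qed.

Lemma linspan_cons S k x y : S x -> linspan S y -> linspan S (k *: x + y).
Proof.
move=> Sx [n [l [z [Sz ->]]]].
exists n.+1, (fun i => if unlift ord0 i is Some j then l j else k),
  (fun i => if unlift ord0 i is Some j then z j else x); split.
  by move=> i; case: (unlift ord0 i).
rewrite big_ord_recl unlift_none; congr (_ + _).
by apply: eq_bigr => i _; rewrite liftK.
Qed.

Lemma linspan_lin S k x y : linspan S x -> linspan S y -> linspan S (k *: x + y).
Proof.
move=> Sx Sy; elim/linspan_ind: x / Sx => [|l x z Sx ih].
  by rewrite scaler0 add0r.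
rewrite scalerDr scalerA -addrA; exact: linspan_cons.
Qed.

Lemma sub_linspan S : S `<=` linspan S.
Proof.
by move=> x Sx; rewrite -[x]addr0 -[x]scale1r; apply: linspan_cons => //; exact: linspan0.
Qed.

End LinSpan.

Section ClosedSpan.
Context {R : realType}.

Definition closed_subspace (V : normedModType R[i]) (N : set V) :=
  [/\ closed N, N 0 & forall k x y, N x -> N y -> N (k *: x + y)].

Definition clspan (V : normedModType R[i]) (S : set V) := closure (linspan S).

Section Fixed.
Variable V : normedModType R[i].
Implicit Types (S N : set V).

(** The way to prove properties of closed spans: check them on generators, and see that
    they define a closed subspace, usually through [closed_subspace_preimage]. *)
Lemma clspan_min S N : closed_subspace N -> S `<=` N -> clspan S `<=` N.
Proof.
move=> [cN N0 Nlin] SN v hv; apply: cN; apply: closure_subset hv.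
by move=> u; apply: linspan_ind => // k x y /SN Nx Ny; exact: Nlin.
Qed.

Lemma sub_clspan S : S `<=` clspan S.
Proof. by move=> x /sub_linspan; exact: subset_closure. Qed.

Lemma clspan_closed_subspace S : closed_subspace (clspan S).
Proof.
split; first exact: closed_closure.
  exact/subset_closure/linspan0.
move=> k x y /closure_nrm Sx /closure_nrm Sy; apply/closure_nrm => e e0.
have d0 : 0 < e / 2 / (modulus k + 1).
  by rewrite !divr_gt0 // ltr_wpDl ?modulus_ge0.
have [x' Sx' xx'] := Sx _ d0.
have [|y' Sy' yy'] := Sy (e / 2); first by rewrite divr_gt0.
exists (k *: x' + y'); first exact: linspan_lin.
have -> : k *: x + y - (k *: x' + y') = k *: (x - x') + (y - y').
  by rewrite scalerBr opprD addrACA.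
apply: (le_lt_trans (nrmD _ _)); rewrite nrmZ.
move: xx'; rewrite ltr_pdivlMr ?ltr_wpDl ?modulus_ge0 //.
have := nrm_ge0 (x - x'); have := modulus_ge0 k; nra.
Qed.

End Fixed.

(** Bounded maps that are additive and homogeneous up to a change of scalars, to treat
    multiplications and the conjugate-linear involution together. *)
Definition semilinear (V W : normedModType R[i]) (f : V -> W) :=
  (exists sigma : R[i] -> R[i], forall k x y, f (k *: x + y) = sigma k *: f x + f y)
  /\ exists K : R, forall x, nrm (f x) <= K * nrm x.

Lemma closed_subspace_preimage (V W : normedModType R[i]) (f : V -> W) (N : set W) :
  semilinear f -> closed_subspace N -> closed_subspace (f @^-1` N).
Proof.
move=> [[sg fl] [K hK]] [cN N0 Nlin]; have f0 : f 0 = 0.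
  by apply: nrm0_eq0; apply/eqP; rewrite eq_le nrm_ge0 andbT; have := hK 0; rewrite nrm0 mulr0.
have sg1 x y : f (x - y) = f x - f y.
  have e u : f u = sg 1 *: f u by have := fl 1 u 0; rewrite f0 !addr0 scale1r.
  have := fl 1 (x - y) y; rewrite scale1r subrK -e => ->.
  by rewrite addrK.
split=> /=; first last.
- by move=> k x y Nx Ny; rewrite fl; exact: Nlin.
- by rewrite /= f0.
move=> x clx; apply: (closed_nrm cN) => e e0.
have d0 : 0 < e / (`|K| + 1) by rewrite divr_gt0 // ltr_wpDl.
have [y Ny xy] := (closure_nrm _ _).1 clx _ d0.
exists (f y) => //; rewrite -sg1; apply: (le_lt_trans (hK _)).
move: xy; rewrite ltr_pdivlMr ?ltr_wpDl //.
have := nrm_ge0 (x - y); have := ler_norm K; nra.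
Qed.

Section CStarMaps.
Context {C : cstarType R}.
Implicit Types (c : C).

Lemma semilinear_mull c : semilinear (fun x : C => c ** x).
Proof.
split; first by exists id => k x y; rewrite cmulDr cmulZr.
by exists (nrm c) => x; exact: nrmM.
Qed.

Lemma semilinear_mulr c : semilinear (fun x : C => x ** c).
Proof.
split; first by exists id => k x y; rewrite cmulDl cmulZl.
by exists (nrm c) => x; rewrite mulrC; exact: nrmM.
Qed.

Lemma semilinear_star : semilinear (fun x : C => x^^*).
Proof.
split; first by exists (fun k => k^*) => k x y; rewrite starD starZ.
by exists 1 => x; rewrite nrm_star mul1r.
Qed.

Lemma semilinear_mul_star c : semilinear (fun x : C => c ** x^^*).
Proof.
split; first by exists (fun k => k^*) => k x y; rewrite starD starZ cmulDr cmulZr.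
by exists (nrm c) => x; rewrite -(nrm_star x); exact: nrmM.
Qed.

Lemma closed_subspace0 : closed_subspace [set 0 : C].
Proof.
split=> //; last by move=> k x y -> ->; rewrite scaler0 addr0.
move=> x /closure_nrm h; apply: nrm_eq0_small => e e0.
by have [_ -> /ltW] := h e e0; rewrite subr0.
Qed.

Lemma cstar_gen_subalgebra (S : set C) : cstar_subalgebra (cstar_gen S).
Proof.
split.
- by apply: closed_bigI => M [] [].
- by move=> M [[]].
- by move=> k x y Mx My M hM; have [[_ _ ml _ _] _] := hM; apply: ml; [exact: Mx|exact: My].
- by move=> x y Mx My M hM; have [[_ _ _ ml _] _] := hM; apply: ml; [exact: Mx|exact: My].
- by move=> x Mx M hM; have [[_ _ _ _ ml] _] := hM; apply: ml; exact: Mx.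
Qed.

Lemma cstar_gen_clspan (S : set C) :
  (forall x y, S x -> S y -> S (x ** y)) -> (forall x, S x -> S (x^^*)) ->
  cstar_gen S `<=` clspan S.
Proof.
move=> SM Sst; have hS := clspan_closed_subspace S; have [cS S0 Sl] := hS.
apply: smallest_sub; last exact: sub_clspan.
split=> //.
- have h x : S x -> clspan S `<=` (fun y => x ** y) @^-1` clspan S.
    move=> Sx; apply: clspan_min; last by move=> y Sy; apply: sub_clspan; exact: SM.
    exact: closed_subspace_preimage (semilinear_mull x) hS.
  move=> x y Sx Sy; move: x Sx.
  suff : clspan S `<=` (fun x => x ** y) @^-1` clspan S by apply.
  apply: clspan_min; last by move=> x Sx; exact: h.
  exact: closed_subspace_preimage (semilinear_mulr y) hS.
- suff : clspan S `<=` (fun x => x^^*) @^-1` clspan S by apply.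
  apply: clspan_min; last by move=> x Sx; apply: sub_clspan; exact: Sst.
  exact: closed_subspace_preimage semilinear_star hS.
Qed.

End CStarMaps.
End ClosedSpan.

(** A limit of images lies in the range, and its preimage is a limit because j is
    isometric. *)
Lemma closed_subspace_image (R : realType) (V W : normedModType R[i]) (j : V -> W)
    (N : set V) : linear j -> (forall x, nrm (j x) = nrm x) -> closed (range j) ->
  closed_subspace N -> closed_subspace (j @` N).
Proof.
move=> jl jn cj [cN N0 Nl]; split.
- move=> c hc; have [a _ ac] : range j c.
    by apply: cj; apply: closure_subset hc => _ [x _ <-]; exists x.
  exists a => //; apply: (closed_nrm cN) => e e0.
  have [_ [b Nb <-]] := (closure_nrm _ _).1 hc e e0.
  rewrite -ac; exists b => //; rewrite -jn addrC -scaleN1r jl scaleN1r addrC.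
  by [].
- exists 0 => //; apply: nrm0_eq0; rewrite jn; exact: nrm0.
- by move=> k _ _ [x Nx <-] [y Ny <-]; exists (k *: x + y); [exact: Nl | exact: jl].
Qed.

Section ConcreteModule.
Context {R : realType} {A C : cstarType R} {X : hilbertBimodType A}.
Variables (iA : A -> C) (iX : X -> C).
Hypothesis iA_isom : forall a, nrm (iA a) = nrm a.
Hypothesis iX_linear : linear iX.
Hypothesis iX_closed : closed (range iX).
Hypothesis iX_rightact : forall x a, iX (rightact x a) = iX x ** iA a.
Hypothesis iX_inner : forall x y, iA (inner x y) = (iX x)^^* ** iX y.

Lemma nrm_iX x : nrm (iX x) = nrm x.
Proof.
apply/eqP; rewrite -(@eqrXn2 _ 2) ?nrm_ge0 // -nrm_cstar -iX_inner iA_isom.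
by apply/eqP; apply: complexI; rewrite rmorphXn /= -!nrmE -inner_norm.
Qed.

Lemma iX0 : iX 0 = 0.
Proof.
have := iX_linear 1 0 0; rewrite !scale1r addr0.
by move=> /(congr1 (fun v => v - iX 0)); rewrite addrK subrr.
Qed.

Lemma iXB x y : iX (x - y) = iX x - iX y.
Proof. by rewrite addrC -scaleN1r iX_linear scaleN1r addrC. Qed.

Lemma iX_subspace : closed_subspace (range iX).
Proof.
split=> //; first by exists 0; rewrite ?iX0.
by move=> k _ _ [x _ <-] [y _ <-]; exists (k *: x + y) => //; rewrite iX_linear.
Qed.

Definition rank_ones : set C := [set c | exists x y, c = iX x ** (iX y)^^*].

(** The copy of the compact operators on X inside C. *)
Definition compacts := clspan rank_ones.

Lemma compacts_subspace : closed_subspace compacts.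
Proof. exact: clspan_closed_subspace. Qed.

Lemma compacts_act d z : compacts d -> exists w, d ** iX z = iX w.
Proof.
move=> hd; suff : range iX (d ** iX z) by move=> [w _ <-]; exists w.
move: d hd; apply: clspan_min.
  exact: closed_subspace_preimage (semilinear_mulr _) iX_subspace.
move=> _ [x [y ->]] /=; exists (rightact x (inner y z)) => //.
by rewrite iX_rightact iX_inner cmulA.
Qed.

Lemma compacts_star d : compacts d -> compacts (d^^*).
Proof.
move: d; apply: clspan_min.
  exact: closed_subspace_preimage semilinear_star compacts_subspace.
by move=> _ [x [y ->]] /=; apply: sub_clspan; exists y, x; rewrite starM starK.
Qed.

Lemma compactsM d e : compacts d -> compacts e -> compacts (d ** e).
Proof.
move=> hd; move: e; apply: clspan_min.
  exact: closed_subspace_preimage (semilinear_mull _) compacts_subspace.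
move=> _ [x [y ->]] /=; rewrite cmulA; have [w ->] := compacts_act x hd.
by apply: sub_clspan; exists w, y.
Qed.

(** If d kills X, it kills all x y^*.  As d^* is a limit of combinations of those,
    d d^* = 0. *)
Lemma compacts_eq0 d : compacts d -> (forall z, d ** iX z = 0) -> d = 0.
Proof.
move=> hd d0; suff : d ** d^^* = 0.
  by rewrite -{1}(starK d) => /cstar_eq0 h; rewrite -(starK d) h star0.
suff : compacts `<=` (fun e => d ** e) @^-1` [set 0] by apply; exact: compacts_star.
apply: clspan_min.
  exact: closed_subspace_preimage (semilinear_mull _) closed_subspace0.
by move=> _ [x [y ->]] /=; rewrite cmulA d0 cmul0l.
Qed.

Lemma compacts_uniq d e : compacts d -> compacts e ->
  (forall z, d ** iX z = e ** iX z) -> d = e.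
Proof.
move=> hd he de; have [_ _ lin] := compacts_subspace.
apply/eqP; rewrite -subr_eq0 addrC -scaleN1r; apply/eqP/compacts_eq0; first exact: lin.
by move=> z; rewrite cmulDl cmulZl de scaleN1r addNr.
Qed.

(** Put g = d d^*.  Powers of g are bounded by powers of c^2 as operators on X.  One
    factor d of finite rank turns this into a bound in norm, up to a constant that
    depends on d only, and [root_bound] removes the constant. *)
Lemma finite_rank_bound d (c : R) : linspan rank_ones d -> 0 < c ->
  (forall z, nrm (d ** iX z) <= c * nrm z) -> nrm d <= c.
Proof.
move=> hd c0 dc; have cd : compacts d by exact: subset_closure.
have [M M0 hM] : exists2 M : R, 0 <= M & forall h t, 0 <= t ->
    (forall z, nrm (h ** iX z) <= t * nrm z) -> nrm (h ** d) <= t * M.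
  clear dc cd; move: d hd; apply: linspan_ind => [|k _ y [x1 [x2 ->]] [M M0 hM]].
    by exists 0 => // h t t0 _; rewrite cmul0r nrm0 mulr0.
  exists (modulus k * (nrm x1 * nrm x2) + M).
    by rewrite addr_ge0 ?mulr_ge0 ?modulus_ge0 ?nrm_ge0.
  move=> h t t0 ht; rewrite cmulDr cmulZr cmulA; apply: (le_trans (nrmD _ _)).
  rewrite nrmZ mulrDr lerD ?hM //.
  rewrite mulrCA ler_wpM2l ?modulus_ge0 // (le_trans (nrmM _ _)) //.
  rewrite nrm_star nrm_iX mulrA ler_wpM2r ?nrm_ge0 //.
have cds := compacts_star cd.
have dsc z : nrm (d^^* ** iX z) <= c * nrm z.
  have [w hw] := compacts_act z cds; rewrite hw.
  have [w0|w0] := eqVneq (nrm w) 0.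
    by rewrite nrm_iX w0 mulr_ge0 ?nrm_ge0 // ltW.
  have pw : 0 < nrm w by rewrite lt0r w0 nrm_ge0.
  rewrite nrm_iX -(ler_pM2l pw) -expr2 -[in leLHS]nrm_iX -nrm_cstar.
  rewrite -{1}hw starM starK -cmulA; apply: (le_trans (nrmM _ _)).
  rewrite nrm_star nrm_iX; have := dc w; have := nrm_ge0 z; nra.
pose g := d ** d^^*.
have sg : g^^* = g by rewrite /g starM starK.
have cg : compacts g by exact: compactsM.
have gc z : nrm (g ** iX z) <= c ^+ 2 * nrm z.
  rewrite /g -cmulA; have [w hw] := compacts_act z cds; rewrite hw.
  apply: (le_trans (dc w)); rewrite -nrm_iX -hw; have := dsc z; nra.
have gnc n z : nrm (cpow g n ** iX z) <= (c ^+ 2) ^+ n.+1 * nrm z.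
  elim: n z => [|n ih] z; first by rewrite expr1; exact: gc.
  rewrite cpowSr -cmulA; have [w hw] := compacts_act z cg; rewrite hw.
  apply: (le_trans (ih w)); rewrite -nrm_iX -hw [(c ^+ 2) ^+ n.+2]exprSr -mulrA.
  by rewrite ler_wpM2l ?gc // !exprn_ge0 // ltW.
suff : nrm g <= c ^+ 2.
  by rewrite nrm_cstarC ler_pXn2r // ?nnegrE ?nrm_ge0 // ltW.
have c2 : 0 < c ^+ 2 by rewrite exprn_gt0.
pose M' := M * nrm d; have M'0 : 0 <= M' by rewrite mulr_ge0 ?nrm_ge0.
apply: (@root_bound _ ((M' + nrm g) / c ^+ 2)); rewrite ?nrm_ge0 ?(ltW c2) //.
(* the index 0 is separate, as one factor of the power is spent on finite rank;
   it accounts for the summand nrm g of the constant *)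
move=> [|n].
  by rewrite !expr1 mulfVK ?lt0r_neq0 // lerDr.
rewrite -nrm_cpow2 //; have : (0 < (2 ^ n.+1).-1)%N.
  by rewrite expnS; have := expn_gt0 2 n; case: (2 ^ n)%N => // m _; rewrite mul2n doubleS.
have := expn_gt0 2 n.+1; case e2: (2 ^ n.+1)%N => [//|[//|m]] _ _ /=.
rewrite -cpowS cpowSr {2}/g cmulA; apply: (le_trans (nrmM _ _)); rewrite nrm_star.
have := hM (cpow g m) _ (ltW (exprn_gt0 m.+1 c2)) (gnc m).
move=> /(ler_wpM2r (nrm_ge0 d)) /le_trans; apply.
rewrite [(c ^+ 2) ^+ m.+2]exprS mulrA mulfVK ?lt0r_neq0 // -mulrA -/M' [leRHS]mulrC.
apply: ler_wpM2l; last by rewrite lerDl nrm_ge0.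
by rewrite exprn_ge0 // ltW.
Qed.

Lemma finite_rank_lift (S : X -> X) :
  linspan [set U | exists x y, U = theta x y] S ->
  exists2 d, linspan rank_ones d & forall z, d ** iX z = iX (S z).
Proof.
move: S; apply: linspan_ind => [|k _ S [x [y ->]] [d hd dS]].
  by exists 0; [exact: linspan0 | move=> z; rewrite cmul0l; exact: esym iX0].
exists (k *: (iX x ** (iX y)^^*) + d).
  by apply: linspan_cons => //; exists x, y.
move=> z; rewrite cmulDl cmulZl dS.
have -> : (k *: theta x y + S) z = k *: theta x y z + S z by [].
by rewrite iX_linear /theta iX_rightact iX_inner cmulA.
Qed.

(** Finite-rank approximations of T come from elements of C; by [finite_rank_bound] they
    form a Cauchy sequence in C. *)
Lemma compact_lift (T : X -> X) : compact_op T ->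
  exists2 d, compacts d & forall z, d ** iX z = iX (T z).
Proof.
move=> [_ hT].
have pos n : 0 < 2^-1 ^+ n :> R by rewrite exprn_gt0 // invr_gt0.
have /choice[u hu] n : exists d, linspan rank_ones d /\
    forall z, nrm (iX (T z) - d ** iX z) <= 2^-1 ^+ n * nrm z.
  have [|S lS hS] := hT (2^-1 ^+ n : R)%:C; first by rewrite ltcR.
  have [d ld dS] := finite_rank_lift lS; exists d; split=> // z.
  by rewrite dS -iXB nrm_iX -lecR rmorphM /= -!nrmE.
have t0 : 0 <= 2^-1 :> R by rewrite invr_ge0.
have t1 : 2^-1 < 1 :> R by lra.
have step n : nrm (u n.+1 - u n) <= 2 * 2^-1 ^+ n.
  apply: finite_rank_bound.
  - rewrite addrC -scaleN1r; apply: linspan_lin; [exact: (hu n).1 | exact: (hu n.+1).1].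
  - by rewrite mulr_gt0.
  move=> z; rewrite cmulBl; apply: (le_trans (nrm_dist (iX (T z)) _ _)).
  rewrite nrmC; have := (hu n).2 z; have := (hu n.+1).2 z; rewrite exprS.
  have := nrm_ge0 z; have := pos n; nra.
have [d hd] := geometric_cvg t0 t1 step.
exists d.
  have [cD _ _] := compacts_subspace; apply: (closed_nrm cD) => e /hd[N hN].
  by exists (u N); [exact/subset_closure/(hu N).1 | rewrite nrmC hN].
move=> z; apply/eqP; rewrite -subr_eq0; apply/eqP; apply: nrm_eq0_small => e e0.
have e1 : 0 < e / 2 / (nrm z + 1) by rewrite !divr_gt0 // ltr_wpDl ?nrm_ge0.
have [N1 h1] := hd _ e1; have [N2 h2] := expr_lt_eps 1 t0 t1 e1.
pose N := maxn N1 N2.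
have := h1 N (leq_maxl _ _); have := h2 N (leq_maxr _ _).
rewrite !ltr_pdivlMr ?ltr_wpDl ?nrm_ge0 // mul1r => a1 a2.
apply: (le_trans (nrm_dist (u N ** iX z) _ _)); rewrite -cmulBl.
have b1 : nrm ((d - u N) ** iX z) <= nrm (u N - d) * nrm z.
  by apply: (le_trans (nrmM _ _)); rewrite nrm_iX (nrmC d).
have b2 : nrm (u N ** iX z - iX (T z)) <= 2^-1 ^+ N * nrm z.
  by rewrite nrmC; exact: (hu N).2.
apply: (le_trans (lerD b1 b2)).
have := nrm_ge0 (u N - d); have := pos N; move: a1 a2 {b1 b2}.
by move: (2^-1 ^+ N) (nrm (u N - d)) (nrm z) => q1 q2 q3; lra.
Qed.

Definition lift_op (T : X -> X) : C :=
  xget 0 [set d | compacts d /\ forall z, d ** iX z = iX (T z)].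

Lemma lift_op_eq T d : compacts d -> (forall z, d ** iX z = iX (T z)) -> lift_op T = d.
Proof.
move=> hd dT; rewrite /lift_op; case: xgetP => [e _ [he eT]|/(_ d)]; last by case; split.
by apply: compacts_uniq => // z; rewrite eT dT.
Qed.

Lemma lift_opP T : compact_op T ->
  compacts (lift_op T) /\ forall z, lift_op T ** iX z = iX (T z).
Proof. by move=> /compact_lift[d hd dT]; rewrite (lift_op_eq hd dT). Qed.

(** Each identity holds because both sides lie in the compacts and act in the same way on
    X. *)
Lemma lift_op_pi1 : pi1_of iX lift_op.
Proof.
split.
- move=> k T S /lift_opP[cT hT] /lift_opP[cS hS]; apply: lift_op_eq.
    by have [_ _ lin] := compacts_subspace; apply: lin.
  by move=> z; rewrite cmulDl cmulZl hT hS iX_linear.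
- move=> T S /lift_opP[cT hT] /lift_opP[cS hS]; apply: lift_op_eq.
    exact: compactsM.
  by move=> z; rewrite -cmulA hS hT.
- move=> T T' /lift_opP[cT hT] TT'; have cTs := compacts_star cT.
  apply: lift_op_eq => // z; have [w hw] := compacts_act z cTs; rewrite hw.
  have h x : (iX x)^^* ** (iX w - iX (T' z)) = 0.
    rewrite cmulBr -hw cmulA -starM hT -!iX_inner TT' subrr //.
  apply/eqP; rewrite -subr_eq0; apply/eqP/cstar_eq0.
  by rewrite -{1}iXB h.
- move=> x y; apply: lift_op_eq; first by apply: sub_clspan; exists x, y.
  by move=> z; rewrite /theta iX_rightact iX_inner cmulA.
Qed.

End ConcreteModule.

(** * The bimodule of an ultragraph *)

Section GSets.
Variable G : ultragraph.

Lemma gsets0 : @gsets G set0.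
Proof. by move=> M [_ sub]; apply: sub; left; left. Qed.

Lemma gsets1 v : @gsets G [set v].
Proof. by move=> M [_ sub]; apply: sub; left; right; exists v. Qed.

Lemma gsets_range e : @gsets G (range_of e).
Proof. by move=> M [_ sub]; apply: sub; right; exists e. Qed.

Lemma gsetsI : setI_closed (@gsets G).
Proof.
move=> U V hU hV M hM; have [[MI _] _] := hM.
by apply: MI; [exact: hU | exact: hV].
Qed.

Lemma gsetsU : setU_closed (@gsets G).
Proof.
move=> U V hU hV M hM; have [[_ MU] _] := hM.
by apply: MU; [exact: hU | exact: hV].
Qed.

End GSets.

Section CKFamily.
Context {R : realType} {G : ultragraph} {B : cstarType R}.
Variables (s : edge G -> B) (p : set (vertex G) -> B).
Hypothesis ck : ck_family s p.

Lemma ck_isom e : s e ** (s e)^^* ** s e = s e. Proof. exact: ck_isometry ck e. Qed.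

Lemma ck_rangeM e : s e ** p (range_of e) = s e.
Proof. by rewrite -(ck_range ck) cmulA ck_isom. Qed.

Lemma ck_sourceM e : p [set source e] ** s e = s e.
Proof.
rewrite -{1}ck_isom cmulA (@cle_projection_mul _ _ _ (s e ** (s e)^^*)) ?ck_isom //.
- exact: ck_projection ck _ (gsets1 _).
- by split; [rewrite cmulA ck_isom | rewrite starM starK].
- exact: ck_source.
Qed.

(** Since p_v s_e = s_e for the source v of e, the product only depends on whether v is
    in U. *)
Lemma ck_setM U e : gsets U ->
  p U ** s e = (if `[< U (source e) >] then 1 else 0) *: s e.
Proof.
move=> hU; rewrite -{1}ck_sourceM cmulA (ck_setI ck hU (gsets1 _)).
case: asboolP => h; first by rewrite setIC setIidl ?ck_sourceM ?scale1r // => _ ->.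
rewrite scale0r (_ : U `&` _ = set0) ?(ck_set0 ck) ?cmul0l //.
by apply/seteqP; split=> // v [Uv vE]; apply: h; rewrite -vE.
Qed.

Lemma ck_edge_orth e f : e <> f -> (s e)^^* ** s f = 0.
Proof.
move=> ef; rewrite -{1}ck_isom -(ck_isom f) !starM starK.
have := ck_orthogonal ck ef; move/(congr1 (fun t => (s e)^^* ** t ** s f)).
by rewrite cmul0r cmul0l !cmulA.
Qed.

Lemma ck_step_elt st e : in_lattice (@gsets G) st ->
  step_elt p st ** s e = step_fun st (source e) *: s e.
Proof.
elim: st => [|b st ih] /=; first by rewrite /step_elt /step_fun !big_nil cmul0l scale0r.
move=> /in_lattice_cons[lb /ih]; rewrite /step_elt /step_fun !big_cons cmulDl => ->.
rewrite cmulZl ck_setM // scalerDl scalerA; congr (_ *: _ + _).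
by case: ifP => _; rewrite ?mulr1 ?mulr0.
Qed.

(** s_e^* s_e is a nonzero projection. *)
Lemma ck_edge_nrm e : s e != 0 -> nrm (s e) = 1.
Proof.
move=> se; have [PP sP] := ck_projection ck (gsets_range e).
have h := nrm_cstar (s e); rewrite (ck_range ck) in h.
have h2 : nrm (p (range_of e)) = nrm (p (range_of e)) ^+ 2.
  by rewrite -nrm_cstar sP PP.
have n0 : 0 < nrm (s e).
  by rewrite lt0r nrm_ge0 andbT; apply: contra se => /eqP /nrm0_eq0 ->.
rewrite h in h2; have := nrm_ge0 (s e).
have : (nrm (s e) ^+ 2) * (nrm (s e) ^+ 2 - 1) = 0 by rewrite mulrBr mulr1 -expr2 -h2 subrr.
move/eqP; rewrite mulf_eq0 sqrf_eq0 (gt_eqF n0) /= subr_eq0 sqrf_eq1.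
by case/orP => /eqP // ->; rewrite oppr_ge0 ler10.
Qed.

End CKFamily.

Section Main.
Variables (R : realType) (G : ultragraph) (hG : no_sinks G).
Variables (C : cstarType R) (s : edge G -> C) (p : set (vertex G) -> C).
Hypothesis hC : universal_ck_family s p.
Variables (A : cstarType R) (iA : A -> C).
Hypothesis hA : ultragraph_coef p iA.
Variables (X : hilbertBimodType A) (iX : X -> C).
Hypothesis hX : ultragraph_bimodule s p iA iX.

Let ck : ck_family s p := uck_family hC.

Let gens : set C := [set c | exists e B, gsets B /\ c = s e ** p B].

Lemma coef_isom a : nrm (iA a) = nrm a.
Proof.
apply: starhom_isometric; [exact: coef_hom hA | exact: coef_inj hA|].
rewrite (coef_range hA); exact: cstar_gen_subalgebra.
Qed.

Lemma coef_closed : closed (range iA).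
Proof. by rewrite (coef_range hA); have [] := cstar_gen_subalgebra (p @` @gsets G). Qed.

Lemma coef_clspan a : clspan (p @` @gsets G) (iA a).
Proof.
apply: cstar_gen_clspan; last by rewrite -(coef_range hA); exists a.
- move=> _ _ [U hU <-] [V hV <-]; exists (U `&` V); first exact: gsetsI.
  by rewrite (ck_setI ck).
- by move=> _ [U hU <-]; exists U => //; have [_ ->] := ck_projection ck hU.
Qed.

Lemma coef_ex U : gsets U -> exists a, iA a = p U.
Proof.
move=> hU; suff [a _ <-] : range iA (p U) by exists a.
by rewrite (coef_range hA); apply: sub_gen_smallest; exists U.
Qed.

Lemma bimod_closed : closed (range iX).
Proof. by rewrite (bimod_range hX); exact: closed_closure. Qed.

Lemma bimod_edge e : exists x, iX x = s e.
Proof.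
suff [x _ <-] : range iX (s e) by exists x.
rewrite (bimod_range hX); apply: sub_clspan; exists e, (range_of e).
by split; [exact: gsets_range | rewrite (ck_rangeM ck)].
Qed.

Let compacts_sub := compacts_subspace iX.

Definition finitely_supported : set C :=
  [set d | exists F : seq (edge G), forall e, e \notin F -> d ** s e = 0].

(** An element x y^* is of this kind if y is a combination of finitely many s_e p_B, since
    distinct edges are orthogonal. *)
Lemma compacts_finitely_supported d (eps : R) : compacts iX d -> 0 < eps ->
  exists2 d', finitely_supported d' & nrm (d - d') < eps.
Proof.
move=> hd e0; have : clspan finitely_supported d.
  have cl := clspan_closed_subspace finitely_supported.
  move: d hd; apply: clspan_min => // _ [x [y ->]].
  have hy : clspan gens (iX y) by rewrite /clspan -(bimod_range hX); exists y.
  move: (iX y) hy; apply: clspan_min.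
    exact: closed_subspace_preimage (semilinear_mul_star _) cl.
  move=> _ [e [U [hU ->]]] /=; apply: sub_clspan; exists [:: e] => f.
  rewrite inE starM -!cmulA => /eqP fe; rewrite (ck_edge_orth ck) ?cmul0r //.
  by move=> ef; apply: fe.
move=> /closure_nrm /(_ eps e0)[d' hd' dd']; exists d' => //.
move: d' hd' {dd'}; apply: linspan_ind => [|k x y [F hF] [F' hF']].
  by exists [::] => e _; rewrite cmul0l.
exists (F ++ F') => e; rewrite mem_cat negb_or => /andP[eF eF'].
by rewrite cmulDl cmulZl hF // hF' // scaler0 addr0.
Qed.

Lemma linspan_step_elt c : linspan (p @` @gsets G) c ->
  exists2 st, in_lattice (@gsets G) st & c = step_elt p st.
Proof.
move: c; apply: linspan_ind => [|k _ _ [U hU <-] [st hst ->]].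
  by exists [::]; rewrite /step_elt ?big_nil.
exists ((k, U) :: st); last by rewrite /step_elt big_cons.
by move=> b [<-|] //; exact: hst.
Qed.

Lemma edge_compact e : compacts iX (s e ** (s e)^^*).
Proof. by have [x <-] := bimod_edge e; apply: sub_clspan; exists x, x. Qed.

Lemma vertex_compact v : finite_set (source (u := G) @^-1` [set v]) ->
  compacts iX (p [set v]).
Proof.
move=> fv; rewrite (ck_vertex ck (hG v) fv) fsbig_finite //.
have [_ c0 cl] := compacts_sub.
by elim/big_rec: _ => // e x _ hx; rewrite -[_ ** _]scale1r; apply: cl => //; exact: edge_compact.
Qed.

(** An element of A that acts compactly on X is approximated by a step element, from
    which the finitely many vertices whose edges all lie in F are split off: those are in
    the compacts, and the remainder is small by [step_elt_bound]. *)
Lemma J_ideal_compacts a : J_ideal X a -> compacts iX (iA a).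
Proof.
move=> Ja; have [hiA hiX] := (coef_hom hA, bimod_linear hX).
have [d hd dE] := compact_lift coef_isom hiX bimod_closed (bimod_rightact hX) (bimod_inner hX) Ja.
have [cD D0 Dl] := compacts_sub; apply: (closed_nrm cD) => eps eps0.
pose e := eps / 4; have e0 : 0 < e by rewrite divr_gt0.
have /closure_nrm /(_ e e0)[_ /linspan_step_elt[st hst ->] ast] := @coef_clspan a.
have [d' [F hF] dd'] := compacts_finitely_supported hd e0.
have small f : f \notin F -> modulus (step_fun st (source f)) <= 2 * e.
  move=> fF; have sf := ck_edge_nrm ck (universal_edge_neq0 hG hC f).
  have -> : modulus (step_fun st (source f)) = nrm (step_elt p st ** s f).
    by rewrite (ck_step_elt ck) // nrmZ sf mulr1.
  have [x xf] := bimod_edge f.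
  have -> : step_elt p st ** s f = (d - d') ** s f - (iA a - step_elt p st) ** s f.
    have := dE x; rewrite (bimod_leftact hX) xf => h.
    rewrite !cmulBl hF // subr0 h opprB addrC subrK //.
  apply: (le_trans (nrmB _ _)).
  have := nrmM (d - d') (s f); have := nrmM (iA a - step_elt p st) (s f).
  rewrite sf !mulr1; move: ast dd'; lra.
pose W := [seq v <- undup (map (source (u := G)) F) |
            `[< forall f, source f = v -> f \in F >]].
(* such vertices are finite emitters, as F is finite *)
have WF v : v \in W -> finite_set (source (u := G) @^-1` [set v]).
  rewrite mem_filter => /andP[/asboolP h _].
  by apply: sub_finite_set (finite_seq F) => f /= /h.
pose y := \sum_(v <- W) step_fun st v *: p [set v].
exists y.
  rewrite /y big_seq; elim/big_rec: _ => // v x vW hx; apply: Dl => //.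
  exact/vertex_compact/WF.
pose st' := st ++ [seq (- step_fun st v, [set v]) | v <- W].
have yE : step_elt p st - y = step_elt p st'.
  rewrite /step_elt big_cat big_map /=; congr (_ + _).
  by rewrite -sumrN; apply: eq_bigr => v _; rewrite scaleNr.
have hst' : in_lattice (@gsets G) st'.
  apply: in_lattice_cat => //.
  by elim: (W) => [|v t ih] b //= [<-|hb]; [exact: gsets1 | exact: (ih _ hb)].
have bound : nrm (step_elt p st') <= 2 * e.
  have e2 : 0 <= 2 * e by rewrite mulr_ge0 // ltW.
  refine (step_elt_bound (@gsets0 G) (@gsetsI G) (@gsetsU G) (ck_projection ck)
    (ck_set0 ck) (ck_setI ck) (ck_setU ck) hst' e2 _).
  move=> v; have -> : step_fun st' v = if v \in W then 0 else step_fun st v.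
    rewrite {1}/step_fun big_cat big_map /= -/(step_fun st v).
    have uW : uniq W by rewrite filter_uniq ?undup_uniq.
    case: ifPn => vW.
      rewrite (bigD1_seq v) //= asboolT // big1 ?addr0 ?subrr // => w wv.
      by rewrite asboolF // => /esym; apply/eqP.
    rewrite big_seq big1 ?addr0 // => w wW; rewrite asboolF // => vw.
    by move: vW; rewrite vw wW.
  case: ifPn => [_|vW]; first by rewrite /modulus normr0 /= mulr_ge0 // ltW.
  have [f fv fF] : exists2 f, source f = v & f \notin F.
    apply: contrapT => no; move/negP: vW; apply.
    have hF' f : source f = v -> f \in F.
      by move=> fv; apply: contrapT => /negP fF; apply: no; exists f.
    (* v itself emits an edge, so it is the source of an edge of F *)
    have [f /= fv] := hG v; rewrite mem_filter mem_undup -fv map_f ?hF' // andbT.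
    by apply/asboolP => f'; rewrite fv; exact: hF'.
  by rewrite -fv; exact: small.
have := nrm_dist (step_elt p st) (iA a) y; rewrite yE.
move: ast bound; rewrite /e; lra.
Qed.

Lemma inclusion_toeplitz : toeplitz iX iA.
Proof.
split; [exact: bimod_linear hX | exact: coef_hom hA | exact: bimod_rightact hX
  | by move=> x y; rewrite (bimod_inner hX) | exact: bimod_leftact hX].
Qed.

Lemma inclusion_covariant : cp_covariant iX iA.
Proof.
have hl := bimod_linear hX.
exists (lift_op iX); split.
  exact: (lift_op_pi1 coef_isom hl bimod_closed (bimod_rightact hX) (bimod_inner hX)).
move=> a Ja; apply: lift_op_eq; first exact: J_ideal_compacts.
by move=> z; rewrite (bimod_leftact hX).
Qed.

Section Target.
Variables (O : cstarType R) (kX : X -> O) (kA : A -> O).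
Hypothesis hO : universal_cp_rep kX kA.
Variables (x_ : edge G -> X) (a_ : set (vertex G) -> A).
Hypothesis x_P : forall e, iX (x_ e) = s e.
Hypothesis a_P : forall U, gsets U -> iA (a_ U) = p U.

Let tp : toeplitz kX kA := ucp_toeplitz hO.
Let iA_inj := coef_inj hA.
Let iX_inj := bimod_inj hX.
Let hiA := coef_hom hA.
Let hkA := toeplitz_hom tp.

Lemma theta_compact x y : compact_op (theta x y : X -> X).
Proof.
split.
  exists (theta y x) => z w; apply: iA_inj; rewrite !(bimod_inner hX) /theta.
  rewrite !(bimod_rightact hX) !(bimod_inner hX) !starM starK !cmulA //.
move=> eps e0; exists (theta x y).
  by apply: sub_linspan; exists x, y.
by move=> z; rewrite subrr normr0 mulr_ge0 // ltW.
Qed.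

(** Linearity of pi^(1) concerns two compact operators, so for a finite sum it is proved
    along with the compactness of the partial sums. *)
Lemma compact_op_sum (F : edge G -> X) (r : seq (edge G)) (rho : (X -> X) -> O) :
  pi1_of kX rho -> let T z := \sum_(e <- r) theta (F e) (F e) z in
  compact_op T /\ rho T = \sum_(e <- r) kX (F e) ** (kX (F e))^^*.
Proof.
move=> hrho; have zero : compact_op (fun=> 0 : X) /\ rho (fun=> 0) = 0.
  have c0 : compact_op (fun=> 0 : X).
    split.
      exists (fun=> 0) => z w; apply: iA_inj; rewrite !(bimod_inner hX).
      by rewrite (iX0 (bimod_linear hX)) star0 cmul0l cmul0r.
    move=> eps e0; exists 0; first exact: linspan0.
    by move=> z; rewrite subrr normr0 mulr_ge0 // ltW.
  split=> //; have := pi1_linear hrho 1 c0 c0.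
  have -> : (fun z : X => 1 *: (0 : X) + 0) = fun=> 0.
    by apply/funext => z; rewrite scaler0 addr0.
  by rewrite scale1r => /(congr1 (fun v => v - rho (fun=> 0))); rewrite addrK subrr.
elim: r => [|e r [cT rT]] /=.
  have -> : (fun z : X => \sum_(e <- [::]) theta (F e) (F e) z) = fun=> 0.
    by apply/funext => z; rewrite big_nil.
  by rewrite big_nil.
set T := fun z => _ in cT rT.
have E : (fun z : X => \sum_(f <- e :: r) theta (F f) (F f) z) =
    (fun z => 1 *: theta (F e) (F e) z + T z).
  by apply/funext => z; rewrite big_cons scale1r.
have ct := theta_compact (F e) (F e).
rewrite E big_cons; split; last first.
  by rewrite (pi1_linear hrho 1 ct cT) scale1r (pi1_theta hrho) rT.
have [[T' TT'] aT] := cT; have [[U' UU'] _] := ct; split.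
  exists (fun w => 1 *: U' w + T' w) => z w; rewrite inner_linearr -TT' -UU'.
  rewrite !scale1r; apply: iA_inj; rewrite (starhomD hiA) !(bimod_inner hX).
  have := bimod_linear hX 1 (theta (F e) (F e) z) (T z); rewrite !scale1r => ->.
  by rewrite starD cmulDl.
move=> eps e0; have [S lS hS] := aT eps e0.
exists (1 *: theta (F e) (F e) + S); first by apply: linspan_cons => //; exists (F e), (F e).
move=> z; have -> : (1 *: theta (F e) (F e) + S) z = 1 *: theta (F e) (F e) z + S z by [].
by rewrite opprD addrACA subrr add0r.
Qed.

(** The relations hold in the bimodule, by injectivity of its inclusion in C, and are
    carried over by the Toeplitz representation.  At a finite emitter v the left action
    of p_v is the sum of the theta (s_e) (s_e), so the relation there is covariance. *)
Lemma image_ck_family : ck_family (kX \o x_) (kA \o a_).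
Proof.
have inn e f : inner (x_ e) (x_ f) = 0 :> A -> (kX (x_ e))^^* ** kX (x_ f) = 0.
  by move=> h; rewrite (toeplitz_inner tp) h (starhom0 hkA).
have range e : inner (x_ e) (x_ e) = a_ (range_of e).
  by apply: iA_inj; rewrite (bimod_inner hX) x_P (ck_range ck) a_P //; exact: gsets_range.
have isom e : kX (x_ e) ** (kX (x_ e))^^* ** kX (x_ e) = kX (x_ e).
  rewrite -cmulA (toeplitz_inner tp) range -(toeplitz_rightact tp); congr kX.
  apply: iX_inj; rewrite (bimod_rightact hX) x_P a_P ?(ck_rangeM ck) //.
  exact: gsets_range.
have proj U : gsets U -> projection (kA (a_ U)).
  move=> hU; have [pp sp] := ck_projection ck hU.
  split; rewrite -?(starhomM hkA) -?(starhomS hkA); congr kA; apply: iA_inj.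
    by rewrite (starhomM hiA) a_P.
  by rewrite (starhomS hiA) a_P.
split=> /=.
- exact: isom.
- move=> e f ef; have h : (kX (x_ e))^^* ** kX (x_ f) = 0.
    apply: inn; apply: iA_inj.
    by rewrite (bimod_inner hX) !x_P (ck_edge_orth ck ef) (starhom0 hiA).
  by rewrite cmulA -(cmulA _ _ (kX (x_ f))) h cmul0r cmul0l.
- exact: proj.
- have -> : a_ set0 = 0; last exact: starhom0.
  apply: iA_inj; rewrite (starhom0 hiA) a_P ?(ck_set0 ck) //; exact: gsets0.
- move=> U V hU hV; rewrite -(starhomM hkA); congr kA; apply: iA_inj.
  rewrite (starhomM hiA) !a_P ?(ck_setI ck) //; exact: gsetsI.
- move=> U V hU hV; rewrite -(starhomD hkA) -(starhomB hkA); congr kA; apply: iA_inj.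
  rewrite (starhomB hiA) (starhomD hiA) !a_P ?(ck_setU ck) //.
    exact: gsetsI.
  exact: gsetsU.
- by move=> e; rewrite (toeplitz_inner tp) range.
- move=> e; apply: cle_of_mul; first exact: proj (gsets1 _).
    by split; [rewrite cmulA isom | rewrite starM starK].
  rewrite cmulA -(toeplitz_leftact tp); congr (kX _ ** _); apply: iX_inj.
  by rewrite (bimod_leftact hX) x_P a_P ?(ck_sourceM ck) //; exact: gsets1.
- move=> v nv fv; have [rho [hrho cov]] := ucp_covariant hO.
  rewrite fsbig_finite //=.
  pose r : seq (edge G) := finmap.enum_fset (fset_set (source (u := G) @^-1` [set v])).
  have [cT <-] := compact_op_sum x_ r hrho.
  have E : leftact (a_ [set v]) = (fun z : X => \sum_(e <- r) theta (x_ e) (x_ e) z).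
    apply/funext => z; apply: iX_inj; rewrite (bimod_leftact hX) a_P; last exact: gsets1.
    rewrite (ck_vertex ck nv fv) fsbig_finite //= cmul_suml.
    elim/big_rec2: _ => [|e u w _ h]; first by rewrite (iX0 (bimod_linear hX)).
    have := bimod_linear hX 1 (theta (x_ e) (x_ e) z) w; rewrite !scale1r => ->.
    by rewrite -h /theta (bimod_rightact hX) (bimod_inner hX) x_P cmulA.
  by rewrite -E cov // /J_ideal /= E.
Qed.

(** Both sides are continuous in a and agree on generators; the set where they agree is
    moved to C, where closed spans are taken. *)
Lemma extend_coef (f : C -> O) : starhom f ->
  (forall U, gsets U -> f (p U) = kA (a_ U)) -> forall a, f (iA a) = kA a.
Proof.
move=> hf hp a; pose N := [set b : A | f (iA b) - kA b = 0].
have hN : closed_subspace N.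
  apply: (@closed_subspace_preimage _ _ _ (fun b => f (iA b) - kA b) [set 0]);
    last exact: closed_subspace0.
  split.
    exists id => k x y; rewrite (starhomZD hiA) (starhomZD hf) (starhomZD hkA).
    by rewrite scalerBr opprD addrACA.
  exists 2 => x; apply: (le_trans (nrmB _ _)).
  have := starhom_contractive hf (iA x); have := starhom_contractive hkA x.
  rewrite (coef_isom x); lra.
have iAl : linear iA by move=> k x y; exact: starhomZD.
have hI := closed_subspace_image iAl coef_isom coef_closed hN.
have [b Nb /iA_inj <-] : (iA @` N) (iA a).
  apply: (clspan_min hI) (@coef_clspan a) => _ [U hU <-].
  exists (a_ U); last exact: a_P.
  by rewrite /N /= a_P // hp // subrr.
by apply/eqP; rewrite -subr_eq0; apply/eqP.
Qed.

Lemma extend_bimod (f : C -> O) : starhom f ->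
  (forall U, gsets U -> f (p U) = kA (a_ U)) -> (forall e, f (s e) = kX (x_ e)) ->
  forall x, f (iX x) = kX x.
Proof.
move=> hf hp hs x; pose N := [set y : X | f (iX y) - kX y = 0].
have kXl := toeplitz_linear tp; have iXl := bimod_linear hX.
have iXn := nrm_iX coef_isom (bimod_inner hX).
have kXn y : nrm (kX y) <= nrm y.
  rewrite -(@ler_pXn2r _ 2) ?nnegrE ?nrm_ge0 // -nrm_cstar (toeplitz_inner tp).
  apply: (le_trans (starhom_contractive hkA _)).
  by rewrite -lecR rmorphXn /= -!nrmE -inner_norm.
have hN : closed_subspace N.
  apply: (@closed_subspace_preimage _ _ _ (fun b => f (iX b) - kX b) [set 0]);
    last exact: closed_subspace0.
  split.
    exists id => k y z; rewrite iXl (starhomZD hf) kXl.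
    by rewrite scalerBr opprD addrACA.
  exists 2 => y; apply: (le_trans (nrmB _ _)).
  have := starhom_contractive hf (iX y); have := kXn y.
  rewrite (iXn y); lra.
have hI := closed_subspace_image iXl iXn bimod_closed hN.
have hx : clspan gens (iX x) by rewrite /clspan -(bimod_range hX); exists x.
have [y Ny /iX_inj <-] : (iX @` N) (iX x).
  apply: (clspan_min hI) hx => _ [e [U [hU ->]]].
  exists (rightact (x_ e) (a_ U)); last by rewrite (bimod_rightact hX) x_P a_P.
  rewrite /N /= (bimod_rightact hX) x_P a_P // (starhomM hf) hs hp //.
  by rewrite (toeplitz_rightact tp) subrr.
by apply/eqP; rewrite -subr_eq0; apply/eqP.
Qed.

End Target.
End Main.

Theorem theorem6p1 (R : realType) (G : ultragraph) (hG : no_sinks G)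
    (C : cstarType R) (s : edge G -> C) (p : set (vertex G) -> C)
    (hC : universal_ck_family s p)
    (A : cstarType R) (iA : A -> C) (hA : ultragraph_coef p iA)
    (X : hilbertBimodType A) (iX : X -> C)
    (hX : ultragraph_bimodule s p iA iX)
    (O : cstarType R) (kX : X -> O) (kA : A -> O)
    (hO : universal_cp_rep kX kA) :
  exists f : C -> O,
    [/\ starhom f, bijective f,
        forall e, exists2 x, iX x = s e & f (s e) = kX x
      & forall B, gsets B -> exists2 a, iA a = p B & f (p B) = kA a].
Proof.
have /choice[x_ x_P] := bimod_edge hC hX.
have /choice[a_ a_P] (U : set (vertex G)) : exists a, gsets U -> iA a = p U.
  have [hU|nU] := pselect (gsets U); last by exists 0.
  by have [a aU] := coef_ex hA hU; exists a.
have [f [[hf fs fp] _]] := uck_universal hC (image_ck_family hC hA hX hO x_P a_P).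
have fA := extend_coef hC hA hO a_P hf fp.
have fX := extend_bimod hA hX hO x_P a_P hf fp fs.
have [g [[hg gX gA] _]] := ucp_universal hO (inclusion_toeplitz hA hX)
  (inclusion_covariant hG hC hA hX).
exists f; split=> //.
- exists g => [c|o].
    have [k [_ uk]] := uck_universal hC (uck_family hC).
    suff e : g \o f = id by rewrite -[RHS]/(id c) -e.
    rewrite -[RHS]uk; last by split=> //; exact: starhom_id.
    symmetry; apply: uk; split; first exact: starhom_comp.
      by move=> e /=; rewrite fs /= gX x_P.
    by move=> U hU /=; rewrite fp //= gA a_P.
  have [k [_ uk]] := ucp_universal hO (ucp_toeplitz hO) (ucp_covariant hO).
  suff e : f \o g = id by rewrite -[RHS]/(id o) -e.
  rewrite -[RHS]uk; last by split=> //; exact: starhom_id.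
  symmetry; apply: uk; split; first exact: starhom_comp.
    by move=> x /=; rewrite gX.
  by move=> a /=; rewrite gA.
- by move=> e; exists (x_ e); rewrite ?x_P // fs.
- by move=> U hU; exists (a_ U); rewrite ?a_P ?fp.
Qed.
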